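(* Fix positive real numbers $c$ and $\alpha$ and set $f(n) = \lceil c n^{\alpha} \rceil$ for $n \ge 1$. (a) If $\alpha = 1$ and $c \ge 1$, then $P(\mathcal{G}(f)) = [1/(2c^2), 1]$. (b) If $\alpha \in (1, 3/2)$, then $P(\mathcal{G}(f)) = [0,1]$. (c) If $\alpha = 3/2$, then $P(\mathcal{G}(f)) = [0, (1+\sqrt{6}\,c)^{-2}]$. (d) If $\alpha > 3/2$, then $P(\mathcal{G}(f)) = \{0\}$.
   Context: Here $\mathbb{N}=\{1,2,\dots\}$. For a non-decreasing function $f:\mathbb{N}\to\mathbb{N}$, let $G_n$ be the grid graph with vertex set $[-f(n),f(n)]^2 \cap \mathbb{Z}^2$, with edges joining pairs of vertices at $L_1$-distance one, and let $\mathcal{G}(f) = (G_n, n\ge 1)$. An activator sequence on $\mathcal{G}(f)$ is a sequence $\mathcal{V} = (v_n, n\ge 1)$ with $v_n \in V(G_n)\cup\{\emptyset\}$ for all $n$, and $v_n \ne \emptyset$ for at least one $n$ (the sequence is ''non-empty''). Repeated vertices, and vertices that are already burning, are allowed; $v_n=\emptyset$ means no vertex is activated on turn $n$. The burning process: $B_0=\emptyset$ and, for $n\ge 1$, $B_n$ is the union of $B_{n-1}$, the set of all neighbours in $G_n$ of vertices of $B_{n-1}$, and $\{v_n\}$ if $v_n\neq\emptyset$. Define $\underline{\delta}(\mathcal{G}(f),\mathcal{V}) = \liminf_{n\to\infty} |B_n|/|V(G_n)|$ and $\overline{\delta}(\mathcal{G}(f),\mathcal{V}) = \limsup_{n\to\infty}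 |B_n|/|V(G_n)|$. If they are equal, the common value is the burning density $\delta(\mathcal{G}(f),\mathcal{V})$. Finally, $P(\mathcal{G}(f))$ is the set of $\rho\in[0,1]$ for which there is a (non-empty) activator sequence $\mathcal{V}$ on $\mathcal{G}(f)$ such that $\delta(\mathcal{G}(f),\mathcal{V})$ exists and equals $\rho$. *)

(* Defs.v *)
From mathcomp Require Import all_boot all_order all_algebra finmap.
From mathcomp Require Import all_classical all_reals all_analysis.
From mathcomp Require Import zify.

Set Implicit Arguments.
Unset Strict Implicit.
Unset Printing Implicit Defensive.

Import Order.TTheory GRing.Theory Num.Theory.
Local Open Scope fset_scope.
Local Open Scope ring_scope.

Definition vertex : Type := (int * int)%type.

Definition segment (m : nat) : {fset int} :=
  [fset (i%:Z - m%:Z) | i in iota 0 (2 * m + 1)].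

Definition grid (m : nat) : {fset vertex} := segment m `*` segment m.

Lemma mem_grid (m : nat) (u : vertex) :
  (u \in grid m) = (`|u.1| <= m%:Z) && (`|u.2| <= m%:Z).
Proof.
have segE (x : int) : (x \in segment m) = (`|x| <= m%:Z).
  apply/idP/idP => [/imfsetP[i /=]|xm].
    by rewrite mem_iota => im ->; lia.
  apply/imfsetP; exists (absz (x + m%:Z)) => /=; last by lia.
  by rewrite mem_iota; lia.
by rewrite in_fsetE !segE.
Qed.

Definition grid_edge (m : nat) (u w : vertex) : bool :=
  [&& u \in grid m, w \in grid m & `|u.1 - w.1| + `|u.2 - w.2| == 1].

Definition neighbours (m : nat) (B : {fset vertex}) : {fset vertex} :=
  [fset u in grid m | has (fun w => grid_edge m w u) B].

(* Turns are numbered from 1, so v 0 is ignored here and in [burning].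
   [None] means that no vertex is activated. *)
Definition activator_sequence (f : nat -> nat) (v : nat -> option vertex) :
    Prop :=
  (forall n u, (1 <= n)%N -> v n = Some u -> u \in grid (f n)) /\
  (exists2 n, (1 <= n)%N & v n <> None).

Fixpoint burning (f : nat -> nat) (v : nat -> option vertex) (n : nat) :
    {fset vertex} :=
  if n is k.+1 then
    burning f v k `|` neighbours (f n) (burning f v k)
      `|` (if v n is Some u then [fset u] else fset0)
  else fset0.

Section Density.
Variable R : realType.

Definition burned_fraction (f : nat -> nat) (v : nat -> option vertex)
    (n : nat) : R :=
  #|` burning f v n|%:R / #|` grid (f n)|%:R.

Definition lower_density (f : nat -> nat) (v : nat -> option vertex) : \bar R :=
  limn_einf (fun n => (burned_fraction f v n)%:E).

Definition upper_density (f : nat -> nat) (v : nat -> option vertex) : \bar R :=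
  limn_esup (fun n => (burned_fraction f v n)%:E).

Definition has_burning_density (f : nat -> nat) (v : nat -> option vertex)
    (rho : R) : Prop :=
  lower_density f v = rho%:E /\ upper_density f v = rho%:E.

Definition burning_densities (f : nat -> nat) : set R :=
  [set rho | 0 <= rho <= 1 /\
     exists v, activator_sequence f v /\ has_burning_density f v rho]%classic.

(* For c > 0 and n >= 1 the ceiling is positive, so the absolute value only
   converts it from int to nat. *)
Definition power_growth (c alpha : R) (n : nat) : nat :=
  absz (Num.ceil (c * (n%:R `^ alpha))).

End Density.
Arguments burning_densities R f : clear implicits.

(* Main.v *)
Require Import Defs.
From mathcomp Require Import all_boot all_order all_algebra finmap.
From mathcomp Require Import all_classical all_reals all_analysis.
From mathcomp Require Import zify ring lra.

Set Implicit Arguments.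
Unset Strict Implicit.
Unset Printing Implicit Defensive.

Import Order.TTheory GRing.Theory Num.Theory.
Import numFieldNormedType.Exports.
Local Open Scope ring_scope.
Local Open Scope classical_set_scope.

(** Why the theorem holds.

    A vertex activated on turn i has burned, by turn n, at most the L1 ball of
    radius n - i about it, and exactly this ball if from turn i on the grid
    grows by at least one unit per turn, so that the fire never catches up with
    the boundary ([burning_sub_balls], [balls_sub_burning]).  All four parts
    compare unions of such balls, of 2r^2 + 2r + 1 points each, with the
    number of vertices of G_n, which is asymptotic to 4 c^2 n^(2 alpha).

    Constraints on a density.  For alpha = 1 and c >= 1 a single ball already
    fills 2 n^2 of the 4 c^2 n^2 vertices, whence the bound 1 / (2 c^2).  All
    the balls together have at most about (2/3) n^3 points, which is negligible
    when alpha > 3/2.  For alpha = 3/2 cut the turns at eps n: the balls lit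
    before lie in the box of half-side c (eps n)^(3/2) + n, and those lit after
    have at most about (2/3) (1 - eps)^3 n^3 points.  Thus B_n has at most about
    (4 c^2 eps^3 + (2/3) (1 - eps)^3) n^3 points ([card_le_critical]); the
    minimum over eps is reached at eps = 1 / (1 + sqrt 6 c) and equals
    4 c^2 eps^2 n^3 ([critical_value]).

    Attaining a density.  One family of activator sequences does everything.
    The hexagon |x| <= M, |y| + lam |x| <= M, with 0 <= lam <= 1, interpolates
    between a square and an L1 ball and has area (4 - 2 lam) M^2.  Activate on
    turn i a vertex of the hexagon of size M = b i^alpha, in such a way that
    the balls of radius r_i about these vertices are pairwise disjoint.  Since
    L1 balls tile the plane, this can be done with 2 r_i^2 asymptotic to the
    area gained by the hexagon on turn i, that is, with r_i asymptotic to
    b sqrt ((4 - 2 lam) alpha) i^(alpha - 1/2) ([packing]).  Disjointness gives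
    |B_n| >= sum_i 2 min (n - i, r_i)^2.

    If alpha < 3/2, then r_i = o(i): nearly all the disjoint balls have burned
    completely by turn n, so they fill the hexagon up to a negligible part
    ([packing_sum_subcritical]), while the fire does not leave the hexagon,
    which grows by one unit per turn ([burning_sub_hexagon]).  The density is
    (4 - 2 lam) b^2 / (4 c^2) ([fill_subcritical]).  Squares suffice for
    1 < alpha; for alpha = 1 the growth forces b >= 1, and one uses L1 balls
    below density 1/2 and hexagons as wide as the grid above it.

    If alpha = 3/2, take squares.  Then r_i is asymptotic to sqrt 6 b i, the
    balls with i < n / (1 + sqrt 6 b) are complete on turn n, and the others
    are still growing without meeting any ball.  The resulting lower bound
    ([packing_sum_critical]) is the upper bound above with b in place of c, so
    the density is (b / (c (1 + sqrt 6 b)))^2 ([fill_critical]), which takes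
    every value of ]0, (1 + sqrt 6 c)^-2] as b ranges over ]0, c].

    A single activated vertex realizes density 0 as soon as alpha > 1. *)

(** * Fire and L1 balls *)

Definition l1 (u w : vertex) : nat :=
  (`|(u.1 - w.1)%R| + `|(u.2 - w.2)%R|)%N.

Lemma l1_eq0 u w : l1 u w = 0%N -> u = w.
Proof. by case: u w => [x y] [a b]; rewrite /l1 /= => d; congr pair; lia. Qed.

Lemma l1C u w : l1 u w = l1 w u.
Proof. by case: u w => [x y] [a b]; rewrite /l1 /=; lia. Qed.

Lemma l1_coord u w :
  (`|u.1| <= `|w.1| + l1 u w)%N /\ (`|u.2| <= `|w.2| + l1 u w)%N.
Proof. by case: u w => [x y] [a b]; rewrite /l1 /=; lia. Qed.

Lemma l1_triangle p u w : (l1 u w <= l1 p u + l1 p w)%N.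
Proof. by case: p u w => [p q] [x y] [a b]; rewrite /l1 /=; lia. Qed.

Lemma burning_sub_balls (f : nat -> nat) v n u :
  u \in burning f v n ->
  exists i w, [/\ (0 < i <= n)%N, v i = Some w & (l1 u w <= n - i)%N].
Proof.
elim: n u => [|n IH] u; first by rewrite in_fset0.
rewrite /= !in_fsetE -orbA => /or3P[/IH[i [w [iP vi d]]]||].
- by exists i, w; split => //; lia.
- case/andP=> _ /hasP[w' /IH[i [w [iP vi d]]] /and3P[_ _ /eqP e]].
  exists i, w; split => //; first by lia.
  by move: d e; rewrite /l1; lia.
- case E : (v n.+1) => [w|]; rewrite ?in_fset0// in_fset1 => /eqP ->.
  by exists n.+1, w; split => //; rewrite /l1; lia.
Qed.

(** A step towards w stays in every box, centred at the origin, that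
    contains both u and w: this is why a grid does not obstruct the fire. *)
Lemma neighbour_closer (u w : vertex) d : l1 u w = d.+1 ->
  exists u', [/\ l1 u' w = d, `|u'.1 - u.1| + `|u'.2 - u.2| = 1
               & (`|u'.1|%N <= maxn `|u.1| `|w.1|)%N /\
                 (`|u'.2|%N <= maxn `|u.2| `|w.2|)%N].
Proof.
case: u w => [x y] [a b]; rewrite /l1 /= => e.
have [xa|xa|xa] := ltgtP x a.
- by exists (x + 1, y); split => /=; [lia|lia|split; lia].
- by exists (x - 1, y); split => /=; [lia|lia|split; lia].
have [yb|yb|yb] := ltgtP y b.
- by exists (x, y + 1); split => /=; [lia|lia|split; lia].
- by exists (x, y - 1); split => /=; [lia|lia|split; lia].
by move: e; rewrite xa yb; lia.
Qed.

(** The ball of radius n - i about w lies in the grid of turn n, because the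
    grid has grown by at least one unit on each turn since turn i; so a vertex
    at distance n - i catches fire from a neighbour that is closer to w. *)
Lemma balls_sub_burning (f : nat -> nat) v i n u w : (0 < i <= n)%N ->
  (forall m, (i <= m)%N -> (f m < f m.+1)%N) ->
  v i = Some w -> w \in grid (f i) -> (l1 u w <= n - i)%N ->
  u \in burning f v n.
Proof.
move=> /andP[i0 le_in] fS vi wi; elim: n le_in u => [|n IH] le_in u; first by lia.
have [ei|ni] := eqVneq i n.+1.
  rewrite ei subnn leqn0 => /eqP/l1_eq0 ->.
  by rewrite /= !in_fsetE -ei vi in_fset1 eqxx !orbT.
have {}le_in : (i <= n)%N by lia.
have [d _|d d'] := leqP (l1 u w) (n - i).
  by rewrite /= !in_fsetE IH.
have {d d'} d : l1 u w = (n - i).+1 by lia.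
have ffi m : (i <= m)%N -> (f i + (m - i) <= f m)%N.
  elim: m => [|m IHm]; first by lia.
  have [->|im le_im] := eqVneq i m.+1; first by rewrite subnn addn0.
  have {}im : (i <= m)%N by lia.
  by have := IHm im; have := fS m im; lia.
have fn := ffi n.+1 (leqW le_in).
have [u' [d' e [m1 m2]]] := neighbour_closer d.
move: wi; rewrite mem_grid => /andP[w1 w2].
have [u1 u2] := l1_coord u w.
have ug : u \in grid (f n.+1).
  by rewrite mem_grid; move: u1 u2; rewrite d; clear -w1 w2 fn le_in; lia.
have ug' : u' \in grid (f n.+1).
  by move: ug; rewrite !mem_grid; clear -m1 m2 w1 w2 fn; lia.
rewrite /= !in_fsetE -orbA; apply/or3P/Or32/andP; split=> //.
apply/hasP; exists u'; first by apply: IH => //; rewrite d'.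
by rewrite /grid_edge ug ug' e eqxx.
Qed.

(** * Counting lattice points *)

(** Listed so that passing from m to m + 1 adds the two points of absolute value
    m + 1, which have the same parity: the counts below are inductions on this
    recursion. *)
Fixpoint seg (m : nat) : seq int :=
  if m is k.+1 then k.+1%:Z :: - k.+1%:Z :: seg k else [:: 0].

Lemma mem_seg m x : (x \in seg m) = (`|x|%N <= m)%N.
Proof.
elim: m => [|m IH] /=; first by rewrite inE; lia.
by rewrite !inE IH; lia.
Qed.

Lemma seg_uniq m : uniq (seg m).
Proof. by elim: m => [|m IH] //=; rewrite !inE !mem_seg IH; lia. Qed.

Lemma size_seg m : size (seg m) = (2 * m + 1)%N.
Proof. by elim: m => [|m IH] //=; rewrite IH; lia. Qed.

Lemma size_seg_parity m b :
  size [seq y <- seg m | odd `|y|%N == b] = (m + (odd m == b))%N.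
Proof.
elim: m => [|m IH] /=; first by case: b.
by case: (odd m) b IH => -[] /= ->; lia.
Qed.

Lemma sum_abs_seg (R : realType) m :
  \sum_(x <- seg m) (`|x|%N)%:R = (m * m.+1)%:R :> R.
Proof.
elim: m => [|m IH] /=; first by rewrite big_seq1.
rewrite !big_cons IH -!natrD; congr (_%:R); lia.
Qed.

Definition columns m (t : int -> seq int) : seq vertex :=
  [seq (x, y) | x <- seg m, y <- t x].

Lemma size_columns m t : size (columns m t) = (\sum_(x <- seg m) size (t x))%N.
Proof. by rewrite size_allpairs_dep sumnE big_map. Qed.

Lemma columns_uniq m t : (forall x, uniq (t x)) -> uniq (columns m t).
Proof.
move=> tu; apply: allpairs_uniq_dep => [|x _|]; rewrite ?seg_uniq//.
by move=> [x1 y1] [x2 y2] _ _ /= [-> ->].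
Qed.

Lemma mem_columns m t u :
  (u \in columns m t) = (`|u.1|%N <= m)%N && (u.2 \in t u.1).
Proof.
apply/allpairsPdep/andP => [[x [y [xm yt ->]]]|[xm yt]] /=.
  by rewrite -mem_seg.
by exists u.1, u.2; rewrite mem_seg; split => //; case: u {xm yt}.
Qed.

Lemma card_grid m : #|` grid m| = ((2 * m + 1) ^ 2)%N.
Proof.
have <- : size (columns m (fun=> seg m)) = ((2 * m + 1) ^ 2)%N.
  rewrite size_columns big_const_seq count_predT size_seg iter_addn_0.
  by rewrite expnSr.
apply/perm_size/uniq_perm; first exact: fset_uniq.
  by apply: columns_uniq => x; exact: seg_uniq.
case=> x y; rewrite mem_columns mem_seg mem_grid /=.
by apply/andP/andP => -[]; lia.
Qed.

Definition l1ball0 r : seq vertex := columns r (fun x => seg (r - `|x|%N)).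

Lemma mem_l1ball0 r u : (u \in l1ball0 r) = (l1 u (0%R, 0%R) <= r)%N.
Proof. by rewrite mem_columns mem_seg /l1 /=; lia. Qed.

Lemma l1ball0_uniq r : uniq (l1ball0 r).
Proof. by apply: columns_uniq => x; exact: seg_uniq. Qed.

(** The induction runs over the columns, with the height s of the central
    column kept fixed. *)
Lemma size_l1ball0 r : size (l1ball0 r) = (2 * r ^ 2 + 2 * r + 1)%N.
Proof.
have key m s : (m <= s)%N -> size (columns m (fun x => seg (s - `|x|%N)))
    = ((2 * m + 1) * (2 * s + 1) - 2 * (m * m.+1))%N.
  rewrite size_columns => ms; under eq_bigr do rewrite size_seg.
  elim: m ms => [|m IH] ms; first by rewrite /= big_seq1; lia.
  by rewrite /= !big_cons IH; [nia|lia].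
by rewrite /l1ball0 key; [nia|lia].
Qed.

Definition l1ball (w : vertex) r : seq vertex :=
  [seq (p.1 + w.1, p.2 + w.2) | p <- l1ball0 r].

Lemma mem_l1ball w r u : (u \in l1ball w r) = (l1 u w <= r)%N.
Proof.
case: u w => [x y] [a b]; apply/mapP/idP => [[[p q]]|h].
  by rewrite mem_l1ball0 /l1 /= => + [-> ->]; lia.
exists (x - a, y - b); last by rewrite /= !subrK.
by rewrite mem_l1ball0; move: h; rewrite /l1 /=; lia.
Qed.

Lemma size_l1ball w r : size (l1ball w r) = (2 * r ^ 2 + 2 * r + 1)%N.
Proof. by rewrite size_map size_l1ball0. Qed.

Lemma l1ball_uniq w r : uniq (l1ball w r).
Proof.
by rewrite map_inj_uniq ?l1ball0_uniq// => -[a b] [a' b'] /= [/addIr -> /addIr ->].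
Qed.

Lemma sum_l1ball_size p :
  (3 * \sum_(l < p) (2 * l ^ 2 + 2 * l + 1) = 2 * p ^ 3 + p)%N.
Proof.
elim: p => [|p IH]; first by rewrite big_ord0.
by rewrite big_ord_recr /= mulnDr IH; nia.
Qed.

(** A square for lam = 0 and an L1 ball for lam = 1, with area
    (4 - 2 lam) M^2 in between. *)
Definition hexagon (R : realType) (lam M : R) (u : vertex) : bool :=
  (`|u.1|%N%:R <= M) && (`|u.2|%N%:R + lam * `|u.1|%N%:R <= M).

Lemma hexagon_le (R : realType) (lam M M' : R) u : M <= M' ->
  hexagon lam M u -> hexagon lam M' u.
Proof. by move=> h /andP[h1 h2]; apply/andP; split; lra. Qed.

(** This uses lam <= 1: a horizontal unit step changes the left-hand side of
    the slanted inequality by lam only. *)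
Lemma hexagon_l1 (R : realType) (lam M : R) u w : 0 <= lam <= 1 ->
  hexagon lam M w -> hexagon lam (M + (l1 u w)%:R) u.
Proof.
case: u w => [x y] [a b] /andP[lam0 lam1] /andP[/= h1 h2].
have hx : (`|x|%N%:R <= `|a|%N%:R + `|(x - a)%R|%N%:R :> R).
  by rewrite -natrD ler_nat; lia.
have hy : (`|y|%N%:R <= `|b|%N%:R + `|(y - b)%R|%N%:R :> R).
  by rewrite -natrD ler_nat; lia.
rewrite /l1 natrD /=; move: hx hy h1 h2 (ler0n R `|(x - a)%R|) (ler0n R `|(y - b)%R|).
by rewrite /hexagon /=; nra.
Qed.

Section counting.
Variables (R : realType) (lam M : R).
Hypotheses (lam01 : 0 <= lam <= 1) (M0 : 0 <= M).

Let height (x : int) : nat := Num.truncn (M - lam * `|x|%N%:R).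

Definition hexagon_seq : seq vertex :=
  columns (Num.truncn M) (fun x => seg (height x)).

(** The L1 balls of radius s tile the plane when their centres are s times
    the points whose two coordinates have the same parity, a lattice of
    index 2; hence half the area of the hexagon in the two counts below. *)
Definition lattice_seq : seq vertex :=
  columns (Num.truncn M)
    (fun x => [seq y <- seg (height x) | odd `|y|%N == odd `|x|%N]).

Let height_itv x : (`|x| <= Num.truncn M)%N ->
  M - lam * `|x|%N%:R - 1 < (height x)%:R <= M - lam * `|x|%N%:R.
Proof.
rewrite truncn_ge_nat// => xM.
have h0 : 0 <= M - lam * `|x|%N%:R.
  by move: xM lam01 (ler0n R `|x|) => xM /andP[l0 l1] x0; nra.
have /andP[h1 h2] := truncn_itv h0.
by rewrite h1 andbT ltrBlDr natr1.
Qed.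

Lemma mem_hexagon_seq u : (u \in hexagon_seq) = hexagon lam M u.
Proof.
rewrite mem_columns mem_seg truncn_ge_nat// /hexagon.
case: leP => //= xM; rewrite truncn_ge_nat ?lerBrDr//.
by move: xM lam01 (ler0n R `|u.1|) => xM /andP[l0 l1] x0; nra.
Qed.

Lemma mem_lattice_seq u :
  (u \in lattice_seq) = hexagon lam M u && (odd `|u.2|%N == odd `|u.1|%N).
Proof.
by rewrite -mem_hexagon_seq !mem_columns mem_filter -andbA; congr andb; rewrite andbC.
Qed.

Lemma lattice_seq_uniq : uniq lattice_seq.
Proof. by apply: columns_uniq => x; rewrite filter_uniq ?seg_uniq. Qed.

Let sum_affine (A : R) m : \sum_(x <- seg m) (A - lam * `|x|%N%:R) =
  (2 * m%:R + 1) * A - lam * (m%:R * (m%:R + 1)).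
Proof.
rewrite big_split /= sumrN -mulr_sumr sum_abs_seg big_const_seq count_predT.
by rewrite size_seg iter_addr_0 -[A *+ _]mulr_natl natrD !natrM -(natr1 m).
Qed.

Let truncM : M - 1 < (Num.truncn M)%:R <= M.
Proof.
by have /andP[h1 h2] := truncn_itv M0; rewrite h1 andbT ltrBlDr natr1.
Qed.

Lemma size_hexagon_seq :
  (size hexagon_seq)%:R <= (4 - 2 * lam) * M ^+ 2 + 6 * M + 1.
Proof.
rewrite size_columns natr_sum.
have h : \sum_(x <- seg (Num.truncn M)) (size (seg (height x)))%:R <=
         \sum_(x <- seg (Num.truncn M)) 2 * ((M + 1/2) - lam * `|x|%N%:R).
  rewrite big_seq [leRHS]big_seq; apply: ler_sum => x; rewrite mem_seg => xm.
  by rewrite size_seg natrD natrM; have /andP[_ ?] := height_itv xm; lra.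
apply: le_trans h _; rewrite -mulr_sumr sum_affine.
move: truncM lam01 M0 (ler0n R (Num.truncn M)); move: (Num.truncn M)%:R => m.
move=> /andP[m1 m2] /andP[l0 l1] Mge m0.
have e1 : lam * (M ^+ 2 - M) <= lam * (m * (m + 1)).
  by apply: ler_wpM2l => //; nra.
have e2 : (2 * m + 1) * (2 * M + 1) <= (2 * M + 1) * (2 * M + 1) by nra.
by have : lam * M <= M; nra.
Qed.

Lemma size_lattice_seq_ge :
  (2 - lam) * M ^+ 2 - 4 * M - 1 <= (size lattice_seq)%:R.
Proof.
rewrite size_columns natr_sum.
have h : \sum_(x <- seg (Num.truncn M)) ((M - 1) - lam * `|x|%N%:R) <=
  \sum_(x <- seg (Num.truncn M))
    (size [seq y <- seg (height x) | odd `|y|%N == odd `|x|%N])%:R.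
  rewrite big_seq [leRHS]big_seq; apply: ler_sum => x; rewrite mem_seg => xm.
  rewrite size_seg_parity natrD; have /andP[? _] := height_itv xm.
  by rewrite -[leLHS]addr0 lerD ?ler0n//; lra.
apply: le_trans h; rewrite sum_affine.
move: truncM lam01 M0; move: (Num.truncn M)%:R => m /andP[m1 m2] /andP[l0 l1] Mge.
have e1 : lam * (m * (m + 1)) <= lam * (M ^+ 2 + M).
  by apply: ler_wpM2l => //; nra.
have e2 : 2 * M ^+ 2 - 3 * M - 1 <= (2 * m + 1) * (M - 1).
  by have [?|?] := leP 1 M; nra.
by have : lam * M <= M; nra.
Qed.

Lemma size_lattice_seq_le :
  (size lattice_seq)%:R <= (2 - lam) * M ^+ 2 + 4 * M + 1.
Proof.
rewrite size_columns natr_sum.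
have h : \sum_(x <- seg (Num.truncn M))
    (size [seq y <- seg (height x) | odd `|y|%N == odd `|x|%N])%:R <=
    \sum_(x <- seg (Num.truncn M)) ((M + 1) - lam * `|x|%N%:R).
  rewrite big_seq [leRHS]big_seq; apply: ler_sum => x; rewrite mem_seg => xm.
  rewrite size_seg_parity natrD; have /andP[_ ?] := height_itv xm.
  have -> : M + 1 - lam * `|x|%N%:R = M - lam * `|x|%N%:R + 1 by lra.
  by rewrite lerD// lern1; case: eqP.
apply: le_trans h _; rewrite sum_affine.
move: truncM lam01 M0 (ler0n R (Num.truncn M)); move: (Num.truncn M)%:R => m.
move=> /andP[m1 m2] /andP[l0 l1] Mge m0.
have e1 : lam * (M ^+ 2 - M) <= lam * (m * (m + 1)).
  by apply: ler_wpM2l => //; nra.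
have e2 : (2 * m + 1) * (M + 1) <= (2 * M + 1) * (M + 1) by nra.
by have : lam * M <= M; nra.
Qed.

End counting.

(** * The size of the burning set *)

(** The vertices lit during the first j turns can only spread by n, hence stay
    in the box of half-side m + n; the ball lit on turn n - l has radius l. *)
Lemma card_burning_le (f : nat -> nat) v n j m :
  (forall i w, (0 < i <= j)%N -> v i = Some w ->
     (`|w.1| <= m)%N /\ (`|w.2| <= m)%N) ->
  (#|` burning f v n| <=
    (2 * (m + n) + 1) ^ 2 + \sum_(l < n - j) (2 * l ^ 2 + 2 * l + 1))%N.
Proof.
move=> hm.
pose late := [seq u | l <- iota 0 (n - j), u <- l1ball (odflt (0, 0) (v (n - l)%N)) l].
have -> : ((2 * (m + n) + 1) ^ 2 + \sum_(l < n - j) (2 * l ^ 2 + 2 * l + 1))%N =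
    size (columns (m + n) (fun=> seg (m + n)) ++ late).
  rewrite size_cat size_columns big_const_seq count_predT size_seg iter_addn_0.
  rewrite expnSr; congr addn; rewrite size_allpairs_dep sumnE big_map.
  rewrite -(big_mkord xpredT (fun l => 2 * l ^ 2 + 2 * l + 1)%N).
  rewrite /index_iota subn0.
  by apply: eq_bigr => l _; rewrite size_l1ball.
apply: uniq_leq_size; first exact: fset_uniq.
move=> u /burning_sub_balls[i [w [/andP[i0 ni] vi d]]].
rewrite mem_cat; have [ij|ji] := leqP i j.
  have [] := hm i w _ vi; first by rewrite i0.
  have [d1 d2] := l1_coord u w.
  rewrite mem_columns mem_seg => w1 w2; apply/orP; left; apply/andP; split.
    by apply: leq_trans d1 (leq_add w1 (leq_trans d (leq_subr _ _))).
  by apply: leq_trans d2 (leq_add w2 (leq_trans d (leq_subr _ _))).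
apply/orP; right; apply/allpairsPdep; exists (n - i)%N, u; split => //.
  by rewrite mem_iota /=; lia.
by rewrite subKn// vi mem_l1ball.
Qed.

(** Shrinking the ball of radius n - i to min (n - i, r_i) makes the balls
    disjoint, so that their sizes add up. *)
Lemma card_burning_ge (f : nat -> nat) v (u : nat -> vertex) (r : nat -> nat) i0 n :
  (0 < i0)%N -> (forall m, (i0 <= m)%N -> (f m < f m.+1)%N) ->
  (forall i, (i0 <= i)%N -> v i = Some (u i) /\ u i \in grid (f i)) ->
  (forall i j, (i0 <= i)%N -> (i < j)%N -> (r i + r j < l1 (u i) (u j))%N) ->
  (\sum_(i0 <= i < n.+1) 2 * minn (n - i) (r i) ^ 2 <= #|` burning f v n|)%N.
Proof.
move=> i00 fS vu disj.
pose s := [seq p | i <- index_iota i0 n.+1, p <- l1ball (u i) (minn (n - i) (r i))].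
apply: (@leq_trans (size s)).
  rewrite size_allpairs_dep sumnE big_map; apply: leq_sum => i _.
  by rewrite size_l1ball; lia.
apply: uniq_leq_size.
  apply: allpairs_uniq_dep; [exact: iota_uniq|by move=> i _; exact: l1ball_uniq|].
  move=> _ _ /allpairsPdep[i [p [ii ip ->]]] /allpairsPdep[j [q [jj jq ->]]] /= e.
  subst q; suff -> : i = j by [].
  move: ii jj ip jq; rewrite !mem_index_iota !mem_l1ball !leq_min.
  move=> /andP[ii _] /andP[jj _] /andP[_ ip] /andP[_ jq].
  have t := l1_triangle p (u i) (u j); have [lij|lji|//] := ltngtP i j.
    by have := disj i j ii lij; lia.
  by have := disj j i jj lji; rewrite l1C; lia.
move=> p /allpairsPdep[i [q [ii + ->]]]; rewrite mem_l1ball leq_min => /andP[d _].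
move: ii; rewrite mem_index_iota ltnS => /andP[ii iN]; have [vi ui] := vu i ii.
apply: (balls_sub_burning _ _ vi ui d).
  by rewrite iN (leq_trans i00).
by move=> m im; apply: fS; exact: leq_trans im.
Qed.

(** A ball centred in the hexagon of turn i grows by one unit per turn, and the
    hexagon grows at least as fast. *)
Lemma burning_sub_hexagon (R : realType) (lam alpha b : R) (f : nat -> nat) v i0 n p :
  0 <= lam <= 1 ->
  (forall m, (i0 <= m)%N -> b * m%:R `^ alpha + 1 <= b * m.+1%:R `^ alpha) ->
  (forall i w, v i = Some w -> (i0 <= i)%N /\ hexagon lam (b * i%:R `^ alpha) w) ->
  p \in burning f v n -> hexagon lam (b * n%:R `^ alpha) p.
Proof.
move=> lam01 bS vh /burning_sub_balls[i [w [/andP[_ iN] /vh[ii hw] d]]].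
apply: hexagon_le (hexagon_l1 p lam01 hw).
apply: (@le_trans _ _ (b * i%:R `^ alpha + (n - i)%:R)); first by rewrite lerD2l ler_nat.
elim: n iN {d} => [|n IH]; first by rewrite leqn0 => /eqP ->; rewrite subnn addr0.
rewrite leq_eqVlt => /predU1P[->|]; first by rewrite subnn addr0.
rewrite ltnS => iN; have := IH iN; have := bS n (leq_trans ii iN).
by rewrite subSn// -natr1; lra.
Qed.

Lemma card_le_cubic (f : nat -> nat) v n : (0 < n)%N ->
  (#|` burning f v n| <= 10 * n ^ 3)%N.
Proof.
move=> n0; have := @card_burning_le f v n 0 0.
have := sum_l1ball_size n; rewrite subn0; move: (\sum_(l < n) _)%N => S SE h.
apply: leq_trans (h _) _; first by case=> [|i] w.
by nia.
Qed.

Definition spark (i : nat) : option vertex :=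
  if i == 1 then Some (0, 0) else None.

Lemma spark_activator (f : nat -> nat) : activator_sequence f spark.
Proof.
split; last by exists 1%N.
move=> n u _; rewrite /spark; case: eqP => // _ [<-].
by rewrite mem_grid /= normr0.
Qed.

Lemma card_spark f n : (0 < n)%N -> (#|` burning f spark n| <= 9 * n ^ 2)%N.
Proof.
move=> n0; have := @card_burning_le f spark n n 0; rewrite subnn big_ord0.
move=> h; apply: leq_trans (h _) _; last by nia.
by move=> i w _; rewrite /spark; case: eqP => // _ [<-].
Qed.

(** * Real powers and limits *)

Lemma nat_ge (R : realType) (x : R) : exists N, forall n, (N <= n)%N -> x <= n%:R.
Proof.
exists (Num.truncn x).+1 => n Nn; apply/ltW/(lt_le_trans (truncnS_gt x)).
by rewrite ler_nat.
Qed.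

Lemma power_ge (R : realType) (s x : R) : 0 < s ->
  exists N, forall n, (N <= n)%N -> x <= n%:R `^ s.
Proof.
move=> s0; have [N HN] := nat_ge (Num.max x 1 `^ s^-1).
exists N => n /HN h; apply: (@le_trans _ _ (Num.max x 1)); first by rewrite le_max lexx.
have m0 : 0 <= Num.max x 1 by rewrite le_max ler01 orbT.
have := ge0_ler_powR (ltW s0) (powR_ge0 _ _) (ler0n R n) h.
by rewrite -powRrM mulVf ?gt_eqF// powRr1.
Qed.

(** Convexity of x^p.  Young's inequality with the conjugate exponent p, p',
    applied to the product y * 1, is Bernoulli's inequality
    p y <= y^p + p - 1; take y = a / b and scale. *)
Lemma powR_tangent (R : realType) (p a b : R) : 1 <= p -> 0 <= a -> 0 <= b ->
  p * b `^ (p - 1) * (a - b) <= a `^ p - b `^ p.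
Proof.
rewrite le_eqVlt => /predU1P[<-|p1] a0.
  by move=> b0; rewrite subrr powRr0 !powRr1// !mul1r.
rewrite le_eqVlt => /predU1P[<-|b0].
  by rewrite powR0 ?powR0 ?mulr0 ?mul0r ?subr0 ?powR_ge0//; lra.
have p0 : 0 < p by lra.
have bernoulli y : 0 <= y -> p * y <= y `^ p + (p - 1).
  move=> y0; have q0 : 0 < (1 - p^-1)^-1 by rewrite invr_gt0 subr_gt0 invf_lt1.
  have := conjugate_powR y0 ler01 p0 q0.
  rewrite invrK powR1 mulr1 mul1r subrKC => /(_ erefl) h.
  rewrite -(ler_pM2l p0) in h; apply: le_trans h _.
  rewrite mulrDr mulrBr mulr1 mulfV ?gt_eqF// mulrCA mulfV ?gt_eqF// mulr1.
  by [].
have := bernoulli (a / b) (divr_ge0 a0 (ltW b0)).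
rewrite powRM ?invr_ge0 ?(ltW b0)// -{2}(powR_inv1 (ltW b0)) -powRrM mulN1r powRN => h.
have bp : 0 < b `^ p by rewrite powR_gt0.
have -> : b `^ (p - 1) = b `^ p * b^-1.
  by rewrite powRB ?gt_eqF ?implybT// powRr1// ltW.
have -> : p * (b `^ p / b) * (a - b) = (p * (a / b) - p) * b `^ p.
  by field; rewrite gt_eqF.
have -> : a `^ p - b `^ p = (a `^ p / b `^ p - 1) * b `^ p.
  by field; rewrite gt_eqF.
by rewrite ler_pM2r//; lra.
Qed.

Lemma powR_bernoulli (R : realType) (p x : R) : 1 <= p -> 0 <= 1 + x ->
  1 + p * x <= (1 + x) `^ p.
Proof.
move=> p1 x1; have := powR_tangent p1 x1 ler01.
by rewrite powR1; lra.
Qed.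

(** For alpha > 1 the increment of b n^alpha is at least
    alpha b n^(alpha - 1), which tends to infinity. *)
Lemma power_step (R : realType) (alpha b : R) :
  0 < b -> 1 <= alpha -> (alpha = 1 -> 1 <= b) ->
  exists N, forall n, (N <= n)%N -> b * n%:R `^ alpha + 1 <= b * n.+1%:R `^ alpha.
Proof.
move=> b0; rewrite le_eqVlt => /predU1P[<- /(_ erefl) b1|a1 _].
  by exists 0%N => n _; rewrite !powRr1// -natr1; lra.
have [|N HN] := @power_ge _ (alpha - 1) b^-1; first by lra.
exists N => n Nn.
have := @powR_tangent _ alpha n.+1%:R n%:R (ltW a1) (ler0n _ _) (ler0n _ _).
rewrite -natr1 addrAC subrr add0r mulr1 => h.
have : b * b^-1 <= b * n%:R `^ (alpha - 1) by rewrite ler_pM2l// HN.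
rewrite mulfV ?gt_eqF// => h1.
have h2 : n%:R `^ (alpha - 1) <= alpha * n%:R `^ (alpha - 1).
  by rewrite ler_peMl ?powR_ge0// ltW.
have : b * n%:R `^ (alpha - 1) <= b * ((n%:R + 1) `^ alpha - n%:R `^ alpha).
  by rewrite ler_pM2l// (le_trans h2).
by lra.
Qed.

Lemma horner_inv_gt0 (R : realType) (p : {poly R}) : 0 < p.[0] ->
  exists N, forall n, (N <= n)%N -> 0 < p.[n%:R^-1].
Proof.
move=> p0.
have h : p.[n%:R^-1] @[n --> \oo] --> p.[0].
  apply: (@cvg_comp _ _ _ (fun n : nat => n%:R^-1 : R) (horner p) \oo (nbhs (0 : R))).
    rewrite gtr0_cvgV0; first exact: cvgr_idn.
    by exists 1%N => // n /= n0; rewrite ltr0n.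
  exact: continuous_horner.
by have [N _ HN] := cvgr_gt _ h _ p0; exists N => n Nn; exact: HN.
Qed.

Lemma cvg_of_bounds (R : realType) (u : nat -> R) (l : R) :
  (forall e, 0 < e -> exists N, forall n, (N <= n)%N -> u n <= l + e) ->
  (forall e, 0 < e -> exists N, forall n, (N <= n)%N -> l - e <= u n) ->
  u n @[n --> \oo] --> l.
Proof.
move=> hu hl; apply/cvgrPdist_le => e e0.
have [N1 H1] := hu e e0; have [N2 H2] := hl e e0.
exists (maxn N1 N2) => // n /=; rewrite geq_max => /andP[/H1 h1 /H2 h2].
by rewrite distrC ler_distl h1 h2.
Qed.

Lemma ratio_cvg0 (R : realType) (u : nat -> R) (C p q : R) : 0 <= C -> p < q ->
  (forall n, (0 < n)%N -> 0 <= u n <= C * n%:R `^ p) ->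
  u n / n%:R `^ q @[n --> \oo] --> 0.
Proof.
move=> C0 pq hu; apply: cvg_of_bounds => e e0; last first.
  exists 1%N => n n0; have /andP[h _] := hu n n0.
  by apply: (@le_trans _ _ 0); [lra|rewrite divr_ge0// powR_ge0].
have [|N HN] := @power_ge _ (q - p) (C / e); first by lra.
exists (maxn 1 N) => n; rewrite geq_max add0r => /andP[n0 /HN h].
have /andP[_ hn] := hu n n0.
have w0 : 0 < n%:R `^ q by rewrite powR_gt0// ltr0n.
rewrite ler_pdivrMr//; apply: le_trans hn _.
have -> : n%:R `^ q = n%:R `^ (q - p) * n%:R `^ p.
  by rewrite -powRD ?subrK// pnatr_eq0 -lt0n n0 implybT.
rewrite mulrA ler_wpM2r ?powR_ge0//.
by rewrite mulrC -ler_pdivrMr.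
Qed.

(** * Densities as limits of rescaled cardinals *)

(** The lower and upper limits squeeze the sequence between its running
    infima and suprema. *)
Lemma has_burning_densityP (R : realType) f v (rho : R) :
  has_burning_density f v rho <->
  burned_fraction R f v n @[n --> \oo] --> rho.
Proof.
rewrite /has_burning_density /lower_density /upper_density; split; last first.
  move=> hr; have h : (burned_fraction R f v n)%:E @[n --> \oo] --> rho%:E.
    by apply/cvg_EFin => //; exact: nearW.
  by have [-> ->] := cvg_limn_einf_sup h.
set u := fun n => _; move=> [hl hu].
have : u n @[n --> \oo] --> rho%:E.
  apply: (@squeeze_cvge _ _ _ _ (einfs u) _ (esups u)).
  - apply: nearW => n; apply/andP; split.
      by apply: ereal_inf_lbound; exists n => //=.
    by apply: ereal_sup_ubound; exists n => //=.
  - by rewrite -hl limn_einf_lim; exact: is_cvg_einfs.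
  - by rewrite -hu limn_esup_lim; exact: is_cvg_esups.
by move=> /fine_cvg.
Qed.

Section growth.
Variables (R : realType) (alpha c : R).
Hypothesis c0 : 0 < c.
Local Notation f := (power_growth c alpha).

Lemma power_growth_itv n : c * n%:R `^ alpha <= (f n)%:R < c * n%:R `^ alpha + 1.
Proof.
have x0 : 0 <= c * n%:R `^ alpha by rewrite mulr_ge0 ?powR_ge0// ltW.
have -> : (f n)%:R = (Num.ceil (c * n%:R `^ alpha))%:~R :> R.
  rewrite /power_growth -[in RHS](@gez0_abs (Num.ceil _))//.
  by rewrite ceil_ge0 (lt_le_trans _ x0)//; lra.
rewrite ceil_ge /= -ltrBlDr.
by have := ceil_itv (c * n%:R `^ alpha); rewrite intrB => /andP[].
Qed.

Lemma power_growth_lt : 1 <= alpha -> (alpha = 1 -> 1 <= c) ->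
  exists N, forall n, (N <= n)%N -> (f n < f n.+1)%N.
Proof.
move=> a1 ac; have [N HN] := power_step c0 a1 ac.
exists N => n /HN h.
have /andP[_ h1] := power_growth_itv n; have /andP[h2 _] := power_growth_itv n.+1.
by rewrite -(ltr_nat R); lra.
Qed.

Lemma grid_ratio : 1 <= alpha ->
  #|` grid (f n)|%:R / n%:R `^ (2 * alpha) @[n --> \oo] --> 4 * c ^+ 2.
Proof.
move=> a1.
apply: (@squeeze_cvgr _ _ _ _ (fun=> 4 * c ^+ 2)
  (fun n : nat => (2 * c + 3 * n%:R^-1) ^+ 2)).
- exists 1%N => // n /= n0; rewrite card_grid natrX natrD natrM.
  have n1 : 1 <= n%:R :> R by rewrite ler1n.
  have nn : n%:R <= n%:R `^ alpha by apply: le1r_powR.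
  have x0 : 0 < n%:R `^ alpha by lra.
  have -> : n%:R `^ (2 * alpha) = (n%:R `^ alpha) ^+ 2.
    by rewrite -powR_mulrn ?ltW// -powRrM; congr (_ `^ _); lra.
  have /andP[h1 h2] := power_growth_itv n.
  rewrite ler_pdivlMr ?exprn_gt0// ler_pdivrMr ?exprn_gt0//; apply/andP; split.
    have -> : 4 * c ^+ 2 * (n%:R `^ alpha) ^+ 2 = (2 * (c * n%:R `^ alpha)) ^+ 2 by ring.
    have cx : 0 <= c * n%:R `^ alpha by rewrite mulr_ge0// ltW.
    by rewrite ler_pXn2r ?nnegrE//; lra.
  have i1 : 1 <= n%:R^-1 * n%:R `^ alpha.
    by rewrite mulrC ler_pdivlMr ?mul1r//; lra.
  have f0 := ler0n R (f n).
  rewrite -exprMn ler_pXn2r ?nnegrE//; last 1 first.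
    by rewrite mulr_ge0 ?addr_ge0 ?mulr_ge0 ?invr_ge0// ?ltW//; lra.
  by lra.
- exact: cvg_cst.
- have h : 2 * c + 3 * n%:R^-1 @[n --> \oo] --> 2 * c + 3 * 0.
    apply: cvgD; first exact: cvg_cst.
    apply: cvgM; first exact: cvg_cst.
    rewrite gtr0_cvgV0; first exact: cvgr_idn.
    by exists 1%N => // n /= n0; rewrite ltr0n.
  have -> : 4 * c ^+ 2 = (2 * c + 3 * 0) * (2 * c + 3 * 0) by ring.
  by under eq_fun do rewrite expr2; exact: cvgM.
Qed.

End growth.

Lemma burned_fraction_rescaled (R : realType) (alpha c : R) v n : (0 < n)%N ->
  #|` burning (power_growth c alpha) v n|%:R / n%:R `^ (2 * alpha) =
  burned_fraction R (power_growth c alpha) v n *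
    (#|` grid (power_growth c alpha n)|%:R / n%:R `^ (2 * alpha)).
Proof.
move=> n0; have w0 : n%:R `^ (2 * alpha) != 0 :> R.
  by rewrite gt_eqF// powR_gt0// ltr0n.
have g0 : #|` grid (power_growth c alpha n)|%:R != 0 :> R.
  by rewrite card_grid pnatr_eq0 expn_eq0 addn1.
by rewrite /burned_fraction; field; rewrite w0 g0.
Qed.

Lemma burned_fraction_cvg (R : realType) (alpha c l : R) v :
  1 <= alpha -> 0 < c ->
  #|` burning (power_growth c alpha) v n|%:R / n%:R `^ (2 * alpha)
    @[n --> \oo] --> l ->
  burned_fraction R (power_growth c alpha) v n
    @[n --> \oo] --> l / (4 * c ^+ 2).
Proof.
move=> a1 c0 h; have hg := grid_ratio c0 a1.
have c2 : 4 * c ^+ 2 != 0 by rewrite mulf_neq0// ?pnatr_eq0// expf_neq0// gt_eqF.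
apply: cvg_trans (cvgM h (cvgV c2 hg)); apply: near_eq_cvg.
exists 1%N => // n /= n0; rewrite burned_fraction_rescaled// mulfK//.
rewrite mulf_neq0 ?invr_eq0 ?gt_eqF ?powR_gt0 ?ltr0n//.
by rewrite card_grid expn_gt0 addn1.
Qed.

Lemma card_ratio_cvg (R : realType) (alpha c rho : R) v :
  1 <= alpha -> 0 < c ->
  burned_fraction R (power_growth c alpha) v n @[n --> \oo] --> rho ->
  #|` burning (power_growth c alpha) v n|%:R / n%:R `^ (2 * alpha)
    @[n --> \oo] --> rho * (4 * c ^+ 2).
Proof.
move=> a1 c0 h; apply: cvg_trans (cvgM h (grid_ratio c0 a1)).
by apply: near_eq_cvg; exists 1%N => // n /= n0; rewrite burned_fraction_rescaled.
Qed.

(** * Packing disjoint balls into growing hexagons *)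

(** Points of the tiling lattice of mesh s, inside the hexagon of size M and
    outside the one of size I. *)
Definition shell (R : realType) (lam M I : R) (s : nat) : seq vertex :=
  [seq u <- [seq (s%:Z * p.1, s%:Z * p.2) | p <- lattice_seq lam (M / s%:R)]
     | ~~ hexagon lam I u].

Section shell.
Variables (R : realType) (lam : R).
Hypothesis lam01 : 0 <= lam <= 1.

Let scale (s : nat) (p : vertex) : vertex := (s%:Z * p.1, s%:Z * p.2).

Let scale_inj s : (0 < s)%N -> injective (scale s).
Proof.
move=> s0 [a b] [a' b'] [/mulfI h1 /mulfI h2].
by rewrite h1 ?h2//; lia.
Qed.

Let hexagon_scale M s u : (0 < s)%N ->
  hexagon lam M (scale s u) = hexagon lam (M / s%:R) u.
Proof.
move=> s0; have s0' : 0 < s%:R :> R by rewrite ltr0n.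
rewrite /hexagon /= !abszM !absz_nat !natrM !ler_pdivlMr//.
by congr (_ && _); congr (_ <= _); ring.
Qed.

Lemma shell_hexagon M I s u : (0 < s)%N -> 0 <= M -> u \in shell lam M I s ->
  hexagon lam M u /\ ~~ hexagon lam I u.
Proof.
move=> s0 M0; rewrite mem_filter => /andP[h /mapP[p pL e]]; split=> //.
move: pL; rewrite mem_lattice_seq ?divr_ge0// => /andP[+ _].
by rewrite -hexagon_scale// e.
Qed.

Lemma shell_uniq M I s : (0 < s)%N -> uniq (shell lam M I s).
Proof.
by move=> s0; rewrite filter_uniq// map_inj_uniq ?lattice_seq_uniq//; exact: scale_inj.
Qed.

(** Two distinct lattice points differ by s (a, b) with a + b even and
    (a, b) <> (0, 0), so |a| + |b| >= 2. *)
Lemma shell_dist M I s u w : (0 < s)%N -> 0 <= M ->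
  u \in shell lam M I s -> w \in shell lam M I s -> u != w ->
  (2 * s <= l1 u w)%N.
Proof.
move=> s0 M0; rewrite !mem_filter.
move=> /andP[_ /mapP[[x y] + ->]] /andP[_ /mapP[[a b] + ->]].
rewrite !mem_lattice_seq ?divr_ge0// => /andP[_ /= /eqP e1] /andP[_ /= /eqP e2] ne.
have d : (2 <= `|(x - a)%R| + `|(y - b)%R|)%N.
  have : (x, y) != (a, b) by apply: contra ne => /eqP[-> ->].
  by rewrite xpair_eqE; lia.
rewrite /l1 /= -!mulrBr !abszM !absz_nat -mulnDr mulnC leq_mul2l d.
by rewrite orbT.
Qed.

(** The difference of the two lattice counts for hexagons of sizes M / s and
    I / s. *)
Lemma size_shell M I s : (0 < s)%N -> 0 <= M -> 0 <= I ->
  (2 - lam) * (M ^+ 2 - I ^+ 2) / s%:R ^+ 2 - 4 * (M + I) / s%:R - 2 <=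
  (size (shell lam M I s))%:R.
Proof.
move=> s0 M0 I0; rewrite /shell size_filter.
set L := map _ _; have := count_predC (hexagon lam I) L.
have cI : (count (hexagon lam I) L <= size (lattice_seq lam (I / s%:R)))%N.
  rewrite -size_filter -[leqRHS](size_map (scale s)); apply: uniq_leq_size.
    rewrite filter_uniq// map_inj_uniq ?lattice_seq_uniq//; exact: scale_inj.
  move=> u; rewrite mem_filter => /andP[uI /mapP[p pL e]].
  have pI : hexagon lam (I / s%:R) p by rewrite -hexagon_scale// /scale -e.
  apply/mapP; exists p => //; move: pL.
  by rewrite !mem_lattice_seq ?divr_ge0// pI => /andP[_ ->].
have {}cI : (count (hexagon lam I) L)%:R <=
    (2 - lam) * (I / s%:R) ^+ 2 + 4 * (I / s%:R) + 1.
  apply: le_trans (size_lattice_seq_le lam01 (divr_ge0 I0 (ler0n R s))).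
  by rewrite ler_nat.
have := size_lattice_seq_ge lam01 (divr_ge0 M0 (ler0n R s)).
move=> h1 h2.
have e : (count (hexagon lam I) L)%:R + (count (predC (hexagon lam I)) L)%:R
   = (size (lattice_seq lam (M / s%:R)))%:R :> R.
  by rewrite -natrD h2 size_map.
suff : (2 - lam) * (M ^+ 2 - I ^+ 2) / s%:R ^+ 2 - 4 * (M + I) / s%:R - 2
  = ((2 - lam) * (M / s%:R) ^+ 2 - 4 * (M / s%:R) - 1) -
    ((2 - lam) * (I / s%:R) ^+ 2 + 4 * (I / s%:R) + 1) by lra.
by field; rewrite pnatr_eq0; lia.
Qed.

End shell.

(** Lattice points minus turns in epoch K, up to a positive factor and as a
    polynomial in 1 / K.  With X = K^(4 alpha - 2), the first term is
    2 - lam times a lower bound for (M^2 - I^2) / (K^3 X^2), where M and I are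
    the sizes of the hexagons that bound the shell; the square is an upper
    bound for (s / X)^2, where s is the mesh; the last factor collects, divided
    by K^3, upper bounds for the boundary terms of [size_shell] and the number
    4 K^3 + 6 K^2 + 4 K + 1 of turns. *)
Definition shell_surplus (R : realType) (lam alpha b beta gamma K : R) : R :=
  (2 - lam) * (8 * alpha * b ^+ 2 * (1 - (8 * alpha - 1) / K)
       - 4 * b * beta / K - 4 * beta ^+ 2 / K ^+ 3)
    - (gamma + K^-1) ^+ 2 * ((8 * b / K + 8 * beta / K ^+ 3) / gamma
       + 2 / K ^+ 3 + 4 + 6 / K + 4 / K ^+ 2 + K ^- 3).

Lemma shell_count_algebra (R : realType) (lam alpha b beta gamma K X M M' T s : R) :
  0 <= lam <= 1 -> 0 < b -> 0 < beta -> 0 < gamma -> 1 <= K <= X ->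
  M = b * (K ^+ 2 * X) -> 0 <= M' <= M -> 0 <= T <= beta * X ->
  gamma * X < s <= gamma * X + 1 ->
  8 * alpha * b ^+ 2 * (K ^+ 3 * X ^+ 2 * (1 - (8 * alpha - 1) / K)) <=
    M ^+ 2 - M' ^+ 2 ->
  0 < shell_surplus lam alpha b beta gamma K ->
  (K + 1) ^+ 4 - K ^+ 4 <= (2 - lam) * (M ^+ 2 - (M' + 2 * T) ^+ 2) / s ^+ 2
    - 4 * (M + (M' + 2 * T)) / s - 2.
Proof.
move=> /andP[l0 l1] b0 be0 g0 /andP[K1 KX] ME.
move=> /andP[M'0 M'M] /andP[T0 TX] /andP[sX1 sX2].
have K0 : 0 < K by lra.
have X0 : 0 < X by lra.
have s0 : 0 < s by apply: lt_trans sX1; exact: mulr_gt0.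
move=> D1; rewrite /shell_surplus; set A := (X in (2 - lam) * X - _).
set E := (X in _ - _ * X) => P0.
have KKE : K ^+ 3 * E = (8 * b * K ^+ 2 + 8 * beta) / gamma + 2 +
    ((K + 1) ^+ 4 - K ^+ 4).
  by rewrite /E; field; rewrite !gt_eqF.
have E0 : 0 < E.
  suff : 0 < K ^+ 3 * E by rewrite pmulr_rgt0// exprn_gt0.
  rewrite KKE; have : 0 < (8 * b * K ^+ 2 + 8 * beta) / gamma.
    by rewrite divr_gt0// addr_gt0// !mulr_gt0// exprn_gt0.
  by nra.
have g1 : 0 < gamma + K^-1 by rewrite addr_gt0// invr_gt0.
have A0 : 0 < A.
  have : 0 < (2 - lam) * A.
    rewrite subr_gt0 in P0; apply: lt_trans P0.
    by rewrite mulr_gt0// exprn_gt0.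
  by rewrite pmulr_rgt0//; lra.
have KA0 : 0 < K ^+ 3 * A by rewrite mulr_gt0// exprn_gt0.
have MI : K ^+ 3 * A * X ^+ 2 <= M ^+ 2 - (M' + 2 * T) ^+ 2.
  have -> : K ^+ 3 * A * X ^+ 2 =
    8 * alpha * b ^+ 2 * (K ^+ 3 * X ^+ 2 * (1 - (8 * alpha - 1) / K))
    - 4 * (beta * X) * M - 4 * (beta * X) ^+ 2.
    by rewrite /A ME; field; rewrite gt_eqF.
  have h1 : M' * T <= (beta * X) * M by rewrite mulrC ler_pM//.
  have h2 : T ^+ 2 <= (beta * X) ^+ 2 by rewrite ler_pXn2r ?nnegrE//; lra.
  by nra.
have sX : s ^+ 2 <= X ^+ 2 * (gamma + K^-1) ^+ 2.
  rewrite -exprMn ler_pXn2r ?nnegrE ?(ltW s0)//; last by rewrite mulr_ge0// ltW.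
  apply: le_trans sX2 _; rewrite mulrDr mulrC lerD2l ler_pdivlMr// mul1r.
  by [].
have step1 : K ^+ 3 * A / (gamma + K^-1) ^+ 2 <= (M ^+ 2 - (M' + 2 * T) ^+ 2) / s ^+ 2.
  rewrite ler_pdivrMr ?exprn_gt0// [leRHS]mulrAC ler_pdivlMr ?exprn_gt0//.
  apply: (@le_trans _ _ (K ^+ 3 * A * (X ^+ 2 * (gamma + K^-1) ^+ 2))).
    by rewrite ler_pM2l.
  by rewrite mulrA ler_pM2r// exprn_gt0.
have step2 : K ^+ 3 * E <= (2 - lam) * ((M ^+ 2 - (M' + 2 * T) ^+ 2) / s ^+ 2).
  apply: (@le_trans _ _ ((2 - lam) * (K ^+ 3 * A / (gamma + K^-1) ^+ 2))); last first.
    by apply: ler_wpM2l step1; lra.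
  rewrite mulrA ler_pdivlMr ?exprn_gt0// [(2 - lam) * _]mulrCA -mulrA.
  rewrite ler_pM2l ?exprn_gt0//.
  by rewrite mulrC; lra.
have step3 : 4 * (M + (M' + 2 * T)) / s <= (8 * b * K ^+ 2 + 8 * beta) / gamma.
  rewrite ler_pdivrMr// [leRHS]mulrAC ler_pdivlMr ?mulr_gt0//.
  apply: (@le_trans _ _ ((8 * b * K ^+ 2 + 8 * beta) * (gamma * X))); last first.
    by rewrite ler_pM2l ?ltW// addr_gt0// !mulr_gt0// exprn_gt0.
  rewrite mulrCA mulrC ler_pM2l//.
  by move: ME M'M TX; lra.
by rewrite mulrA in step2; lra.
Qed.

(** At 1 / K = 0 the polynomial equals 4 beta^2 - 4 gamma^2. *)
Lemma shell_surplus_gt0 (R : realType) (lam alpha b beta gamma : R) :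
  beta ^+ 2 = (4 - 2 * lam) * alpha * b ^+ 2 -> 0 < gamma < beta ->
  exists N, forall k, (N <= k)%N -> 0 < shell_surplus lam alpha b beta gamma k%:R.
Proof.
move=> beE /andP[g0 gb].
(* The surplus as a polynomial A - (gamma + h)^2 E in h = 1 / K. *)
pose A : {poly R} := (8 * alpha * b ^+ 2)%:P * (1%:P - (8 * alpha - 1)%:P * 'X)
  - (4 * b * beta)%:P * 'X - (4 * beta ^+ 2)%:P * 'X ^+ 3.
pose E : {poly R} := ((8 * b)%:P * 'X + (8 * beta)%:P * 'X ^+ 3) * gamma^-1%:P
  + 2%:P * 'X ^+ 3 + 4%:P + 6%:P * 'X + 4%:P * 'X ^+ 2 + 'X ^+ 3.
pose P : {poly R} := (2 - lam)%:P * A - (gamma%:P + 'X) ^+ 2 * E.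
have P0 : 0 < P.[0].
  rewrite /P /E /A !(hornerD, hornerN, hornerM, hornerC, hornerX, horner_exp).
  rewrite [X in 0 < X](_ : _ = 4 * ((4 - 2 * lam) * alpha * b ^+ 2) - 4 * gamma ^+ 2).
    by rewrite -beE; nra.
  by field; rewrite gt_eqF.
have [N HN] := horner_inv_gt0 P0.
exists (maxn 1 N) => k; rewrite geq_max => /andP[k1 /HN].
rewrite /P /E /A !(hornerD, hornerN, hornerM, hornerC, hornerX, horner_exp).
have k0 : k%:R != 0 :> R by rewrite pnatr_eq0 -lt0n.
rewrite /shell_surplus; congr (0 < _).
by field; rewrite k0 gt_eqF.
Qed.

(** In epoch k, the turns from k^4 to (k + 1)^4, use the shell between the
    hexagons of sizes b (k - 1)^(4 alpha) and b k^(4 alpha).  Its width is of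
    order k^(4 alpha - 1) and the mesh of order k^(4 alpha - 2), so that
    boundary effects are a fraction 1 / k of the count; and a mesh slightly
    smaller than the critical one, gamma < beta, leaves at least one lattice
    point for each turn of the epoch. *)
Lemma shell_count (R : realType) (lam alpha b beta gamma : R) :
  0 <= lam <= 1 -> 1 <= alpha -> 0 < b -> 0 < beta ->
  beta ^+ 2 = (4 - 2 * lam) * alpha * b ^+ 2 -> 0 < gamma < beta ->
  exists N, forall k, (N <= k)%N ->
  (k.+1 ^ 4 - k ^ 4 <= size (shell lam (b * k%:R `^ (4 * alpha))
     (b * k.-1%:R `^ (4 * alpha) +
        2 * (Num.truncn (beta * k%:R `^ (4 * alpha - 2)))%:R)
     (Num.truncn (gamma * k%:R `^ (4 * alpha - 2))).+1))%N.
Proof.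
move=> /andP[l0 l1] a1 b0 be0 beE /andP[g0 gb].
have [N0 HN0] := @shell_surplus_gt0 _ lam alpha b _ _ beE (introT andP (conj g0 gb)).
have [N1 HN1] := nat_ge (8 * alpha).
exists (maxn 2 (maxn N0 N1)) => k Nk.
move: Nk; rewrite !geq_max => /and3P[k2 kN0 kN1].
have Ka := HN1 k kN1.
have kK : k.-1%:R = k%:R - 1 :> R by rewrite -subn1 natrB//; exact: ltnW.
set K : R := k%:R in Ka kK *.
have K2 : 2 <= K by rewrite ler_nat.
set X := K `^ (4 * alpha - 2).
have K0 : 0 < K by lra.
have KX : K <= X by apply: le1r_powR; lra.
have X0 : 0 < X by lra.
have K0' : K != 0 by rewrite gt_eqF.
have E1 : K `^ (4 * alpha) = K ^+ 2 * X.
  by rewrite -powR_mulrn ?(ltW K0)// -powRD ?K0' ?implybT//; congr (_ `^ _); lra.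
have E2 : K `^ (8 * alpha) = (K `^ (4 * alpha)) ^+ 2.
  by rewrite -powR_mulrn ?powR_ge0// -powRrM; congr (_ `^ _); lra.
have E3 : K `^ (8 * alpha - 1) = K ^+ 3 * X ^+ 2.
  rewrite -!powR_mulrn ?(ltW K0) ?(ltW X0)// -powRrM -powRD ?K0' ?implybT//.
  by congr (_ `^ _); lra.
have E4 : k.-1%:R `^ (8 * alpha) = (k.-1%:R `^ (4 * alpha)) ^+ 2 :> R.
  by rewrite -[RHS]powR_mulrn ?powR_ge0// -powRrM; congr (_ `^ _); lra.
set M := b * K `^ (4 * alpha); set M' := b * k.-1%:R `^ (4 * alpha).
set T : R := (Num.truncn (beta * X))%:R.
have T01 : 0 <= T <= beta * X.
  by rewrite ler0n /= truncn_le mulr_ge0// ltW.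
have sP : gamma * X < (Num.truncn (gamma * X)).+1%:R <= gamma * X + 1.
  rewrite truncnS_gt /= -natr1 lerD2r truncn_le mulr_ge0//; exact: ltW.
have M0 : 0 <= M by rewrite mulr_ge0 ?powR_ge0// ltW.
have M'0 : 0 <= M' by rewrite mulr_ge0 ?powR_ge0// ltW.
have M'M : M' <= M.
  rewrite ler_pM2l// ge0_ler_powR ?nnegrE//; first by lra.
  by rewrite ler_nat leq_pred.
(* The gain k^(8 alpha) - (k - 1)^(8 alpha), bounded below by convexity and then
   by Bernoulli's inequality. *)
have D1 : 8 * alpha * b ^+ 2 * (K ^+ 3 * X ^+ 2 * (1 - (8 * alpha - 1) / K)) <=
    M ^+ 2 - M' ^+ 2.
  have -> : M ^+ 2 - M' ^+ 2 = b ^+ 2 * (K `^ (8 * alpha) - k.-1%:R `^ (8 * alpha)).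
    by rewrite E2 E4 /M /M'; ring.
  have -> : 8 * alpha * b ^+ 2 * (K ^+ 3 * X ^+ 2 * (1 - (8 * alpha - 1) / K)) =
    b ^+ 2 * (8 * alpha * (K ^+ 3 * X ^+ 2 * (1 + (8 * alpha - 1) * - K^-1))) by ring.
  rewrite ler_pM2l ?exprn_gt0//.
  rewrite -E3 kK; apply: (@le_trans _ _
    (8 * alpha * (K - 1) `^ (8 * alpha - 1) * (K - (K - 1)))); last first.
    by apply: powR_tangent; lra.
  rewrite opprB addrCA subrr addr0 mulr1 ler_pM2l; last by lra.
  have -> : K - 1 = K * (1 + - K^-1) by field.
  have K1 : 0 <= 1 + - K^-1 by rewrite subr_ge0 invf_le1//; lra.
  rewrite powRM ?(ltW K0)// ler_pM2l ?powR_gt0//.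
  by apply: powR_bernoulli => //; lra.
have lam01 : 0 <= lam <= 1 by rewrite l0.
have := @shell_count_algebra R lam alpha b beta gamma K X M M' T _
  lam01 b0 be0 g0 _ _ _ T01 sP D1.
have -> : 1 <= K <= X by rewrite KX; lra.
rewrite {1}/M E1 M'0 M'M => /(_ isT erefl isT) h.
rewrite -(ler_nat R) natrB ?leq_exp2r// !natrX -(natr1 k).
apply: le_trans (size_shell lam01 _ M0 _) => //; last by rewrite addr_ge0// mulr_ge0//; lra.
by apply: h; exact: HN0.
Qed.

Lemma epoch i : exists k, (k ^ 4 <= i < k.+1 ^ 4)%N.
Proof.
have ex : exists k, (k ^ 4 <= i)%N by exists 0%N.
have ub k : (k ^ 4 <= i)%N -> (k <= i)%N.
  by apply: leq_trans; case: k => // k; rewrite -{1}(expn1 k.+1) leq_pexp2l.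
case: (ex_maxnP ex ub) => k ki kmax; exists k; rewrite ki ltnNge.
by apply/negP => /kmax; rewrite ltnn.
Qed.

(** Each epoch k takes the largest radius, up to the critical one, for which
    its shell has a lattice point for every turn; by [shell_count] this radius
    is eventually at least gamma k^(4 alpha - 2) for every gamma < beta.  The
    inner hexagon of the shell is enlarged by twice the critical radius, which
    keeps the balls of different epochs apart. *)
Lemma packing (R : realType) (lam alpha b : R) :
  0 <= lam <= 1 -> 1 <= alpha -> 0 < b ->
  exists (v : nat -> vertex) (r : nat -> nat) (i0 : nat),
  [/\ forall i, (i0 <= i)%N -> hexagon lam (b * i%:R `^ alpha) (v i),
      forall i j, (i0 <= i)%N -> (i < j)%N -> (r i + r j < l1 (v i) (v j))%N
    & forall gamma, 0 < gamma -> gamma ^+ 2 < (4 - 2 * lam) * alpha * b ^+ 2 ->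
      exists N, forall i, (N <= i)%N ->
        gamma * i%:R `^ (alpha - 1 / 2) <= (r i)%:R].
Proof.
move=> lam01 a1 b0; have /andP[l0 l1'] := lam01.
set B := (4 - 2 * lam) * alpha * b ^+ 2.
have B0 : 0 < B by rewrite /B !mulr_gt0//; lra.
pose beta := Num.sqrt B.
have be0 : 0 < beta by rewrite sqrtr_gt0.
have beE : beta ^+ 2 = B by rewrite sqr_sqrtr// ltW.
pose q := 4 * alpha - 2.
pose m k := b * k%:R `^ (4 * alpha).
pose Rk k := Num.truncn (beta * k%:R `^ q).
pose I k := m k.-1 + 2 * (Rk k)%:R.
pose N k := (k.+1 ^ 4 - k ^ 4)%N.
(* Mesh r + 1 keeps the points of a shell at distance at least 2 r + 2. *)
pose cnt k r := size (shell lam (m k) (I k) r.+1).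
pose rad k := (\max_(r < (Rk k).+1 | N k <= cnt k r) r)%N.
have rad_le k : (rad k <= Rk k)%N.
  by apply/bigmax_leqP => r _; rewrite -ltnS.
have rad_ge k r : (r <= Rk k)%N -> (N k <= cnt k r)%N -> (r <= rad k)%N.
  move=> rR Nr; have rR' : (r < (Rk k).+1)%N by [].
  exact: (@leq_bigmax_cond _ (fun r : 'I_(Rk k).+1 => N k <= cnt k r)%N _ (Ordinal rR')).
have rad_ok k r : (r <= Rk k)%N -> (N k <= cnt k r)%N -> (N k <= cnt k (rad k))%N.
  move=> rR Nr; have rR' : (r < (Rk k).+1)%N by [].
  have [|r' + e] := @eq_bigmax_cond _ (fun r : 'I_(Rk k).+1 => N k <= cnt k r)%N (fun r => r).
    by apply/card_gt0P; exists (Ordinal rR').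
  by rewrite /rad e.
have cntP gamma : 0 < gamma < beta -> exists k0, forall k, (k0 <= k)%N ->
    let r := Num.truncn (gamma * k%:R `^ q) in (r <= Rk k)%N /\ (N k <= cnt k r)%N.
  move=> /andP[g0 gb].
  have [k0 Hk0] := shell_count lam01 a1 b0 be0 beE (introT andP (conj g0 gb)).
  exists k0 => k /Hk0 ?; split=> //.
  by apply: le_truncn; rewrite ler_wpM2r ?powR_ge0// ltW.
have [k0 Hk0] : exists k0, forall k, (k0 <= k)%N -> (N k <= cnt k (rad k))%N.
  have [|k0 Hk0] := cntP (beta / 2); first by lra.
  by exists k0 => k /Hk0 /= [h1 h2]; exact: rad_ok h1 h2.
have [kk kkP] := choice epoch.
have kk_le i j : (i <= j)%N -> (kk i <= kk j)%N.
  move=> ij; have /andP[h1 _] := kkP i; have /andP[_ h2] := kkP j.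
  rewrite -ltnS -(ltn_exp2r _ _ (isT : 0 < 4)%N).
  exact: leq_ltn_trans h1 (leq_ltn_trans ij h2).
have kk_ge k i : (k ^ 4 <= i)%N -> (k <= kk i)%N.
  move=> ki; have /andP[_ h2] := kkP i.
  by rewrite -ltnS -(ltn_exp2r _ _ (isT : 0 < 4)%N); apply: leq_ltn_trans ki h2.
pose sh k := shell lam (m k) (I k) (rad k).+1.
pose v i := nth (0%R, 0%R) (sh (kk i)) (i - kk i ^ 4).
have m0 k : 0 <= m k by rewrite mulr_ge0 ?powR_ge0// ltW.
have m_le k k' : (k <= k')%N -> m k <= m k'.
  move=> kk'; rewrite ler_pM2l// ge0_ler_powR ?nnegrE ?ler_nat//; lra.
have R_le k k' : (k <= k')%N -> (Rk k <= Rk k')%N.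
  move=> kk'; apply: le_truncn; rewrite ler_pM2l// ge0_ler_powR ?nnegrE ?ler_nat//.
  by rewrite /q; lra.
have v_sh i : (k0 ^ 4 <= i)%N -> v i \in sh (kk i).
  move=> /kk_ge/Hk0; have /andP[h1 h2] := kkP i => h.
  by apply: mem_nth; apply: leq_trans h; rewrite /N ltn_sub2r// (leq_ltn_trans h1).
have v_hex i : (k0 ^ 4 <= i)%N ->
    hexagon lam (m (kk i)) (v i) /\ ~~ hexagon lam (I (kk i)) (v i).
  by move=> /v_sh; apply: shell_hexagon.
exists v, (fun i => rad (kk i)), (k0 ^ 4)%N; split.
- move=> i i0; have [h _] := v_hex _ i0; apply: hexagon_le h.
  rewrite ler_pM2l// powRrM ge0_ler_powR ?nnegrE ?powR_ge0//; first by lra.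
  by rewrite powR_mulrn// -natrX ler_nat; have /andP[] := kkP i.
- move=> i j i0 ij; have j0 : (k0 ^ 4 <= j)%N by apply: leq_trans i0 (ltnW ij).
  have [e|ne] := eqVneq (kk i) (kk j).
    have vj : v j \in sh (kk i) by rewrite e; exact: v_sh.
    have h := @shell_dist R lam lam01 (m (kk i)) (I (kk i)) (rad (kk i)).+1 _ _
      isT (m0 _) (v_sh _ i0) vj.
    rewrite -e.
    have {h} : (2 * (rad (kk i)).+1 <= l1 (v i) (v j))%N.
      apply: h; rewrite /v -e.
      have /andP[i1 i2] := kkP i; have /andP[j1 j2] := kkP j.
      have Nc := Hk0 _ (kk_ge _ _ i0).
      rewrite nth_uniq ?shell_uniq//.
      + rewrite eqn_leq negb_and -!ltnNge; apply/orP; right.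
        by rewrite ltn_sub2r// (leq_ltn_trans i1).
      + by apply: leq_trans Nc; rewrite /N ltn_sub2r// (leq_ltn_trans i1).
      + by apply: leq_trans Nc; rewrite /N e ltn_sub2r// (leq_ltn_trans j1).
    by lia.
  (* In distinct epochs, v_i lies in the hexagon of an earlier epoch, and v_j at
     distance more than twice the critical radius from it. *)
  have lt : (kk i < kk j)%N by rewrite ltn_neqAle ne kk_le// ltnW.
  rewrite ltnNge; apply/negP => d.
  have [hi _] := v_hex _ i0; have [_ /negP] := v_hex _ j0; apply.
  have := hexagon_l1 (v j) lam01 hi; apply: hexagon_le.
  apply: lerD; first by apply: m_le; rewrite -ltnS prednK// (leq_ltn_trans _ lt).
  rewrite -natrM ler_nat mul2n -addnn.
  rewrite l1C.
  apply: leq_trans d _; apply: leq_add; last exact: rad_le.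
  by apply: leq_trans (rad_le _) (R_le _ _ (ltnW lt)).
move=> gamma g0 gB.
have gb : gamma < beta by rewrite -(@ltr_pXn2r _ 2) ?nnegrE ?ltW// beE.
(* Rounding and the change from i to k^4 are absorbed between gamma and g. *)
pose g := (gamma + beta) / 2.
have [|k1 Hk1] := cntP g; first by rewrite /g; lra.
have [k2 Hk2] := nat_ge ((g * q + 1) / (g - gamma)).
exists (maxn k1 (maxn 1 k2) ^ 4)%N => i /kk_ge; set k := kk i.
rewrite !geq_max => /and3P[/Hk1 [h1 h2] k_gt0 /Hk2 hk].
have rk : (Num.truncn (g * k%:R `^ q))%:R <= (rad k)%:R :> R.
  by rewrite ler_nat rad_ge.
have tr : g * k%:R `^ q - 1 < (Num.truncn (g * k%:R `^ q))%:R.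
  by rewrite ltrBlDr natr1 truncnS_gt.
have iK : i%:R `^ (alpha - 1 / 2) <= k.+1%:R `^ q :> R.
  have -> : q = 4%:R * (alpha - 1 / 2) by rewrite /q; lra.
  rewrite powRrM ge0_ler_powR ?nnegrE ?powR_ge0//; first by lra.
  by rewrite powR_mulrn// -natrX ler_nat; have /andP[_ /ltnW] := kkP i.
apply: le_trans (ler_wpM2l (ltW g0) iK) _.
apply: le_trans rk; apply: le_trans (ltW tr).
have q1 : 1 <= q by rewrite /q; lra.
have kR : 1 <= k%:R :> R by rewrite ler1n.
have tang := powR_tangent q1 (ler0n R k) (ler0n R k.+1).
rewrite -natr1 in tang *; set K : R := k%:R in tang kR hk tr *.
have X1 : K + 1 <= (K + 1) `^ q by apply: le1r_powR => //; lra.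
have XE : (K + 1) `^ q = (K + 1) `^ (q - 1) * (K + 1).
  by rewrite mulrC mulr_powRB1//; lra.
set Y := (K + 1) `^ (q - 1) in tang XE.
have Y1 : 1 <= Y.
  have K1 : 1 <= K + 1 by lra.
  by have := ler_powR K1 (_ : 0 <= q - 1); rewrite powRr0; apply; lra.
rewrite XE in tang *.
have hk' : g * q + 1 <= (g - gamma) * (K + 1).
  have gg : 0 < g - gamma by rewrite /g; lra.
  by move: hk; rewrite ler_pdivrMr//; lra.
have gg : 0 < g by rewrite /g; lra.
have : g * (Y * (K + 1) - q * Y) <= g * K `^ q by rewrite ler_pM2l//; lra.
have : Y * (g * q + 1) <= Y * ((g - gamma) * (K + 1)) by rewrite ler_pM2l//; lra.
by lra.
Qed.

(** * Lower bounds from packings *)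

(** Telescoping: by convexity 2 alpha i^(2 alpha - 1) is at least
    i^(2 alpha) - (i - 1)^(2 alpha). *)
Lemma core_sum (R : realType) (alpha : R) M j : 1 <= alpha -> (M <= j.+1)%N ->
  (j%:R `^ (2 * alpha) - M%:R `^ (2 * alpha)) / alpha <=
  \sum_(M <= i < j.+1) 2 * i%:R `^ (2 * alpha - 1).
Proof.
move=> a1 Mj; pose u (k : nat) : R := k.-1%:R `^ (2 * alpha).
have uM : u M <= M%:R `^ (2 * alpha).
  by rewrite ge0_ler_powR ?nnegrE// ?ler_nat ?leq_pred//; lra.
apply: (@le_trans _ _ ((u j.+1 - u M) / alpha)).
  by rewrite ler_pM2r ?invr_gt0; [rewrite lerD2l lerN2|lra].
rewrite -telescope_sumr// mulr_suml; apply: ler_sum => i _.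
rewrite ler_pdivrMr; last by lra.
rewrite /u /=; case: i => [|i] /=.
  by rewrite subrr !mulr_ge0 ?powR_ge0//; lra.
have a2 : 1 <= 2 * alpha by lra.
have := powR_tangent a2 (ler0n R i) (ler0n R i.+1).
by rewrite -natr1; move: (_ `^ (2 * alpha - 1)) => X; lra.
Qed.

(** Telescoping: 3 x^2 >= x^3 - (x - 1)^3 for x >= 1. *)
Lemma cubic_sum (R : realType) j n : (j <= n)%N ->
  2 / 3 * ((n - j)%:R - 1) ^+ 3 <=
  \sum_(j.+1 <= i < n.+1) 2 * ((n - i)%:R ^+ 2) :> R.
Proof.
rewrite leq_eqVlt => /predU1P[->|jn].
  by rewrite subnn big_geq//; lra.
rewrite big_nat_recr//= subnn expr0n mulr0 addr0.
pose u (k : nat) : R := - (n - k)%:R ^+ 3.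
apply: (@le_trans _ _ (2 / 3 * \sum_(j.+1 <= i < n) (u i.+1 - u i))).
  rewrite telescope_sumr// /u subnn expr0n oppr0 add0r opprK.
  have -> // : (n - j.+1)%:R = (n - j)%:R - 1 :> R.
  by rewrite subnS -subn1 [LHS]natrB ?subn_gt0.
rewrite mulr_sumr; apply: ler_sum_nat => i /andP[_ iN].
rewrite /u; have -> : (n - i.+1)%:R = (n - i)%:R - 1 :> R.
  by rewrite subnS -subn1 [LHS]natrB ?subn_gt0.
have : 1 <= (n - i)%:R :> R by rewrite ler1n subn_gt0.
by move: (n - i)%:R => x; nra.
Qed.

Lemma cube_shift (R : realType) (x y : R) : 0 <= y -> y - 1 <= x ->
  y ^+ 3 - 3 * y ^+ 2 - 1 <= x ^+ 3.
Proof.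
move=> y0 xy; have cubes : (y - 1) ^+ 3 <= x ^+ 3.
  have [x0|x0] := leP 0 x; have [y1|y1] := leP 1 y.
  - by rewrite ler_pXn2r ?nnegrE//; lra.
  - apply: (@le_trans _ _ 0); last by rewrite exprn_ge0.
    by have : 0 <= (1 - y) ^+ 3; [rewrite exprn_ge0//|]; lra.
  - by lra.
  have : (- x) ^+ 3 <= (1 - y) ^+ 3 by rewrite ler_pXn2r ?nnegrE//; lra.
  by lra.
by lra.
Qed.

(** The map t / (1 + t) is 1-Lipschitz with values in [0, 1], so replacing beta
    by gamma costs at most (4/3) (beta - gamma). *)
Lemma critical_ratio_close (R : realType) (beta gamma e : R) :
  0 < gamma -> gamma < beta -> beta - gamma <= e / 4 ->
  2 / 3 * (beta / (1 + beta)) ^+ 2 - e / 2 <= 2 / 3 * (gamma / (1 + gamma)) ^+ 2.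
Proof.
move=> g0 gb be.
have range (t : R) : 0 < t -> 0 <= t / (1 + t) <= 1.
  by move=> t0; rewrite divr_ge0 ?ler_pdivrMr//=; lra.
have /andP[u0 u1] := range _ (lt_trans g0 gb); have /andP[w0 w1] := range _ g0.
have close : beta / (1 + beta) - gamma / (1 + gamma) <= beta - gamma.
  have -> : beta / (1 + beta) - gamma / (1 + gamma) =
      (beta - gamma) / ((1 + beta) * (1 + gamma)).
    by field; rewrite !gt_eqF//; lra.
  have bg : 1 <= (1 + beta) * (1 + gamma) by nra.
  rewrite ler_pdivrMr; last by lra.
  by rewrite ler_peMr//; lra.
move: u0 u1 w0 w1 close be; move: (beta / _) (gamma / _) => x y.
move=> x0 x1 y0 y1 xy be.
have sum2 : 0 <= (2 - (x + y)) * (beta - gamma) by rewrite mulr_ge0//; lra.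
have diff : (x - y) * (x + y) <= (beta - gamma) * (x + y).
  by apply: ler_wpM2r xy; lra.
by lra.
Qed.

(** A bound, in units of n^2, for what rounding and the turns before M cost in
    [critical_main_term]. *)
Definition critical_error (R : realType) (gamma M : R) : R :=
  gamma ^+ 2 * (3 * (1 + gamma) ^- 2 + 1 + M ^+ 3) +
  3 * (gamma / (1 + gamma)) ^+ 2 + 1.

(** J and L stand for j^3 and (n - j - 1)^3, where j is the integer part of
    ep n.  As ep (1 + gamma) = 1, the two main terms
    gamma^2 ep^3 n^3 and gamma^3 ep^3 n^3 add up to (gamma ep)^2 n^3. *)
Lemma critical_main_term (R : realType) (gamma n M J L : R) (ep := (1 + gamma)^-1) :
  0 < gamma -> 0 <= M ^+ 3 -> 1 <= n ->
  (ep * n) ^+ 3 - 3 * (ep * n) ^+ 2 - 1 <= J ->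
  (gamma * ep * n) ^+ 3 - 3 * (gamma * ep * n) ^+ 2 - 1 <= L ->
  2 / 3 * (gamma / (1 + gamma)) ^+ 2 * n ^+ 3 - critical_error gamma M * n ^+ 2
    <= gamma ^+ 2 / (3 / 2) * (J - M ^+ 3) + 2 / 3 * L.
Proof.
move=> g0 M0 n1; rewrite /critical_error -exprVn -/ep => hJ hL.
have g2 : 0 < gamma ^+ 2 by rewrite exprn_gt0.
have gJ : gamma ^+ 2 * ((ep * n) ^+ 3 - 3 * (ep * n) ^+ 2 - 1) <= gamma ^+ 2 * J.
  by rewrite ler_pM2l.
have cubes : gamma ^+ 2 * (ep * n) ^+ 3 + (gamma * ep * n) ^+ 3 =
    (gamma * ep) ^+ 2 * n ^+ 3.
  by rewrite /ep; field; rewrite gt_eqF//; lra.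
have n2 : 1 <= n ^+ 2 by exact: exprn_ege1.
have gM : gamma ^+ 2 * (1 + M ^+ 3) <= gamma ^+ 2 * ((1 + M ^+ 3) * n ^+ 2).
  by rewrite ler_pM2l// ler_peMr//; lra.
have gM0 : 0 <= gamma ^+ 2 * (1 + M ^+ 3) by rewrite mulr_ge0 ?ltW//; lra.
have s1 : 0 <= gamma ^+ 2 * (ep * n) ^+ 2 by rewrite mulr_ge0 ?sqr_ge0.
have s2 : 0 <= (gamma * ep * n) ^+ 2 by rewrite sqr_ge0.
have -> : gamma ^+ 2 / (3 / 2) * (J - M ^+ 3) =
    2 / 3 * (gamma ^+ 2 * J) - 2 / 3 * (gamma ^+ 2 * M ^+ 3) by field.
move: gJ hL cubes n2 gM gM0 s1 s2; clear; move: (M ^+ 3) => M3.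
by lra.
Qed.

Section lower.
Variables (R : realType) (alpha : R) (r : nat -> nat) (i0 : nat).
Hypothesis a1 : 1 <= alpha.

Let term n i : R := (2 * minn (n - i) (r i) ^ 2)%:R.

Let a0 : 0 < alpha. Proof. exact: lt_le_trans a1. Qed.

(** On turn n the ball lit on a turn i <= j has reached the radius
    gamma i^(alpha - 1/2), so it contributes at least
    2 gamma^2 i^(2 alpha - 1). *)
Let core (gamma : R) N n j : 0 < gamma ->
  (forall i, (N <= i)%N -> gamma * i%:R `^ (alpha - 1 / 2) <= (r i)%:R) ->
  (maxn i0 N <= j.+1)%N ->
  (forall i, (i <= j)%N -> gamma * i%:R `^ (alpha - 1 / 2) <= (n - i)%:R) ->
  gamma ^+ 2 / alpha * (j%:R `^ (2 * alpha) - (maxn i0 N)%:R `^ (2 * alpha)) <=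
  \sum_(i0 <= i < j.+1) term n i.
Proof.
move=> g0 hr Mj hn.
rewrite (big_cat_nat _ (n := maxn i0 N)) ?leq_maxl//=.
rewrite -[leLHS]add0r lerD//; first by apply: sumr_ge0 => i _.
apply: (@le_trans _ _ (\sum_(maxn i0 N <= i < j.+1)
  gamma ^+ 2 * (2 * i%:R `^ (2 * alpha - 1)))).
  rewrite -mulr_sumr -mulrA ler_pM2l ?exprn_gt0// mulrC.
  exact: core_sum.
apply: ler_sum_nat => i /andP[]; rewrite geq_max ltnS => /andP[_ Ni] ij.
rewrite /term natrM natrX mulrCA ler_pM2l//.
have -> : i%:R `^ (2 * alpha - 1) = (i%:R `^ (alpha - 1 / 2)) ^+ 2.
  by rewrite -[RHS]powR_mulrn ?powR_ge0// -powRrM; congr (_ `^ _); lra.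
rewrite -exprMn ler_pXn2r ?nnegrE// ?mulr_ge0 ?powR_ge0 ?(ltW g0)//.
by rewrite /minn; case: ifP => _; [exact: hn|exact: hr].
Qed.

(** P stands for the area of the hexagon of size b, so that gamma^2 < alpha P is
    the range of gamma in [packing].  As alpha - 1/2 < 1, for n large all the
    balls lit before turn (1 - h) n are complete on turn n. *)
Lemma packing_sum_subcritical (P : R) : alpha < 3 / 2 -> 0 < P ->
  (forall gamma, 0 < gamma -> gamma ^+ 2 < alpha * P ->
      exists N, forall i, (N <= i)%N ->
        gamma * i%:R `^ (alpha - 1 / 2) <= (r i)%:R) ->
  forall e, 0 < e -> exists N, forall n, (N <= n)%N ->
    (P - e) * n%:R `^ (2 * alpha) <= \sum_(i0 <= i < n.+1) term n i.
Proof.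
move=> a2 P0 hr e e0; have ag0 := a0; have ag1 := a1.
have [Pe|eP] := leP P e.
  exists 0%N => n _; apply: (@le_trans _ _ 0); last by apply: sumr_ge0.
  by rewrite mulr_le0_ge0 ?powR_ge0// subr_le0.
(* Half of e pays for gamma^2 = alpha Q < alpha P, the other half for the
   margin h. *)
pose Q := P - e / 2; have Q0 : 0 < Q by rewrite /Q; lra.
pose gamma := Num.sqrt (alpha * Q).
have aQ : 0 < alpha * Q by rewrite mulr_gt0.
have g0 : 0 < gamma by rewrite sqrtr_gt0.
have gE : gamma ^+ 2 = alpha * Q by rewrite sqr_sqrtr// ltW.
have [|N HN] := hr gamma g0.
  by rewrite gE ltr_pM2l; [rewrite /Q; lra|lra].
have [h h0 hE] : exists2 h, 0 < h & h * (2 * P * (4 * alpha + 1)) = e.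
  exists (e / (2 * P * (4 * alpha + 1))); first by rewrite divr_gt0// !mulr_gt0//; lra.
  by rewrite mulfVK// !mulf_neq0// gt_eqF//; lra.
have h1 : h <= 1 / 10.
  have hP : h * (10 * P) <= e by rewrite -hE ler_pM2l//; nra.
  by rewrite -(ler_pM2r P0); lra.
set M := maxn i0 N.
have [|N1 H1] := @power_ge _ (3 / 2 - alpha) (gamma / h); first by lra.
have [N2 H2] := nat_ge h^-1.
have [|N3 H3] := @power_ge _ (2 * alpha) (M%:R `^ (2 * alpha) / h); first by lra.
exists (maxn (maxn 1 (2 * M)) (maxn N1 (maxn N2 N3))) => n.
rewrite !geq_max => /andP[/andP[n0 nM] /and3P[/H1 k1 /H2 k2 /H3 k3]].
have nR : 1 <= n%:R :> R by rewrite ler1n.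
have nMR : 2 * M%:R <= n%:R :> R by rewrite -natrM ler_nat.
pose j := Num.truncn ((1 - h) * n%:R).
have x0 : 0 <= (1 - h) * n%:R by rewrite mulr_ge0//; lra.
have /andP[j1 j2] := truncn_itv x0; rewrite -/j -natr1 in j1 j2.
have hn1 : 1 <= h * n%:R.
  by rewrite -ler_pdivrMl// mulr1.
have jn : (j <= n)%N by rewrite -(ler_nat R); nra.
rewrite (big_cat_nat _ (n := j.+1)) ?ltnS//=; last first.
  rewrite (leq_trans (leq_maxl i0 N))// -/M -(ler_nat R) -natr1.
  by nra.
rewrite -[leLHS]addr0 lerD//; last by apply: sumr_ge0.
apply: le_trans (core g0 HN _ _); last 2 first.
- by rewrite -/M -(ler_nat R) -natr1; nra.
- move=> i ij; rewrite natrB; last exact: leq_trans jn.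
  have iR : i%:R <= j%:R :> R by rewrite ler_nat.
  apply: (@le_trans _ _ (gamma * n%:R `^ (alpha - 1 / 2))).
    rewrite ler_pM2l// ge0_ler_powR ?nnegrE//; first by lra.
    by rewrite ler_nat (leq_trans ij).
  apply: (@le_trans _ _ (h * n%:R)); last by nra.
  have {2}<- : n%:R `^ (3 / 2 - alpha) * n%:R `^ (alpha - 1 / 2) = n%:R.
    rewrite -powRD; last by rewrite gt_eqF ?implybT//; lra.
    by rewrite -[RHS]powRr1//; congr (_ `^ _); lra.
  rewrite mulrA ler_wpM2r ?powR_ge0//.
  by move: k1; rewrite ler_pdivrMr// mulrC.
rewrite -/M gE [alpha * Q]mulrC mulfK; last by rewrite gt_eqF//; lra.
have w0 : 0 < n%:R `^ (2 * alpha) by rewrite powR_gt0//; lra.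
have jw : (1 - 4 * alpha * h) * n%:R `^ (2 * alpha) <= j%:R `^ (2 * alpha).
  apply: (@le_trans _ _ (((1 - 2 * h) * n%:R) `^ (2 * alpha))); last first.
    apply: ge0_ler_powR; rewrite ?nnegrE//; [lra| |nra].
    by rewrite mulr_ge0//; lra.
  rewrite powRM//; last by lra.
  rewrite ler_pM2r//; have := @powR_bernoulli _ (2 * alpha) (- (2 * h)).
  by move=> B; apply: le_trans (B _ _); lra.
have Mw : M%:R `^ (2 * alpha) <= h * n%:R `^ (2 * alpha).
  by move: k3; rewrite ler_pdivrMr// [_ * h]mulrC.
move: jw Mw w0; move: (n%:R `^ _) (j%:R `^ _) (M%:R `^ _) => w x y jw Mw w0.
have : Q * ((1 - (4 * alpha + 1) * h) * w) <= Q * (x - y).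
  by rewrite ler_pM2l//; lra.
apply: le_trans; rewrite mulrA ler_pM2r// /Q.
by nra.
Qed.

(** Here the radii are gamma i.  The balls lit before turn n / (1 + gamma) are
    complete on turn n, whereas the later ones have the radius n - i, still
    smaller than gamma i; both groups contribute. *)
Lemma packing_sum_critical (P : R) : alpha = 3 / 2 -> 0 < P ->
  (forall gamma, 0 < gamma -> gamma ^+ 2 < alpha * P ->
      exists N, forall i, (N <= i)%N ->
        gamma * i%:R `^ (alpha - 1 / 2) <= (r i)%:R) ->
  let beta := Num.sqrt (alpha * P) in
  forall e, 0 < e -> exists N, forall n, (N <= n)%N ->
    (2 / 3 * (beta / (1 + beta)) ^+ 2 - e) * n%:R `^ (2 * alpha) <=
    \sum_(i0 <= i < n.+1) term n i.
Proof.
move=> aE P0 hr beta e e0; have ag0 := a0.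
have aP : 0 < alpha * P by rewrite mulr_gt0.
have b0 : 0 < beta by rewrite sqrtr_gt0.
have bE : beta ^+ 2 = alpha * P by rewrite sqr_sqrtr// ltW.
(* The maximum keeps gamma positive. *)
pose gamma := Num.max (beta / 2) (beta - e / 4).
have [g1 g2] : beta / 2 <= gamma /\ beta - e / 4 <= gamma.
  by rewrite /gamma !le_max !lexx orbT.
have gbe : beta - gamma <= e / 4 by lra.
have gb : gamma < beta by rewrite /gamma gt_max; apply/andP; split; lra.
have g0 : 0 < gamma by lra.
have [|N HN] := hr gamma g0.
  by rewrite -bE ltr_pXn2r ?nnegrE// ltW.
have w3 n : n%:R `^ (2 * alpha) = n%:R ^+ 3 :> R.
  by rewrite -powR_mulrn//; congr (_ `^ _); lra.
set M := maxn i0 N.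
pose ep := (1 + gamma)^-1.
have ep0 : 0 < ep by rewrite invr_gt0; lra.
have epE : gamma * ep = 1 - ep by rewrite /ep; field; rewrite gt_eqF//; lra.
pose C := critical_error gamma M%:R.
have [N1 H1] := nat_ge (2 * C / e).
have [N2 H2] := nat_ge (M%:R / ep).
exists (maxn 1 (maxn N1 N2)) => n; rewrite !geq_max => /and3P[n0 /H1 k1 /H2 k2].
have nR : 1 <= n%:R :> R by rewrite ler1n.
pose j := Num.truncn (ep * n%:R).
have x0 : 0 <= ep * n%:R by rewrite mulr_ge0// ltW.
have /andP[j1 j2] := truncn_itv x0; rewrite -/j -natr1 in j1 j2.
have ep1 : ep <= 1 by nra.
have jn : (j <= n)%N by rewrite -(ler_nat R); nra.
have Mj : (M <= j.+1)%N.
  rewrite -(ler_nat R) -natr1.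
  by move: k2; rewrite ler_pdivrMr//; lra.
rewrite (big_cat_nat _ (n := j.+1)) ?ltnS//=; last first.
  by apply: leq_trans Mj; exact: leq_maxl.
have i1 (i : nat) : i%:R `^ (alpha - 1 / 2) = i%:R :> R.
  by rewrite -[RHS]powRr1//; congr (_ `^ _); lra.
have h1 : gamma ^+ 2 / alpha * (j%:R ^+ 3 - M%:R ^+ 3) <= \sum_(i0 <= i < j.+1) term n i.
  rewrite -!w3; apply: core => // i ij; rewrite i1 natrB ?(leq_trans ij)//.
  have : i%:R <= j%:R :> R by rewrite ler_nat.
  move=> iR; have : (1 + gamma) * i%:R <= (1 + gamma) * (ep * n%:R).
    by rewrite ler_pM2l; lra.
  by rewrite mulrA /ep mulfV ?mul1r; [lra|rewrite gt_eqF//; lra].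
have h2 : 2 / 3 * ((n - j)%:R - 1) ^+ 3 <= \sum_(j.+1 <= i < n.+1) term n i.
  apply: le_trans (cubic_sum _ jn) _; apply: ler_sum_nat => i /andP[ji iN].
  rewrite /term natrM natrX ler_pM2l// ler_pXn2r ?nnegrE// ler_nat leq_min leqnn /=.
  have Ni : (N <= i)%N by apply: leq_trans ji; apply: leq_trans Mj; exact: leq_maxr.
  rewrite -(ler_nat R); apply: le_trans (HN i Ni); rewrite i1 natrB; last by rewrite -ltnS.
  have iR : j%:R + 1 <= i%:R :> R by rewrite natr1 ler_nat.
  have : (1 + gamma) * (ep * n%:R) <= (1 + gamma) * i%:R.
    by rewrite ler_pM2l; lra.
  by rewrite mulrA /ep mulfV ?mul1r; [lra|rewrite gt_eqF//; lra].
apply: le_trans (lerD h1 h2); rewrite w3 aE natrB//.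
have c1 : (ep * n%:R) ^+ 3 - 3 * (ep * n%:R) ^+ 2 - 1 <= j%:R ^+ 3.
  by apply: cube_shift => //; rewrite lerBlDr ltW.
have c2 : (gamma * ep * n%:R) ^+ 3 - 3 * (gamma * ep * n%:R) ^+ 2 - 1 <=
    (n%:R - j%:R - 1) ^+ 3.
  apply: cube_shift; first by rewrite -mulrA mulr_ge0// ltW.
  by rewrite epE lerD2r mulrBl mul1r lerD2l lerN2.
apply: le_trans (critical_main_term g0 _ nR c1 c2); last by rewrite exprn_ge0.
have gl := critical_ratio_close g0 gb gbe.
have gl3 : (2 / 3 * (beta / (1 + beta)) ^+ 2 - e / 2) * n%:R ^+ 3 <=
    2 / 3 * (gamma / (1 + gamma)) ^+ 2 * n%:R ^+ 3.
  by apply: ler_wpM2r gl; rewrite exprn_ge0.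
have Cn : C * n%:R ^+ 2 <= e / 2 * n%:R ^+ 3.
  have -> : e / 2 * n%:R ^+ 3 = n%:R * (e / 2) * n%:R ^+ 2 :> R by ring.
  rewrite ler_pM2r ?exprn_gt0 ?ltr0n//.
  by rewrite ler_pdivrMr// in k1; clear -k1; lra.
by rewrite -/C; clear -gl3 Cn; lra.
Qed.

End lower.

(** * Upper bounds *)

Lemma card_le_hexagon (R : realType) (lam alpha b : R) (B : nat -> {fset vertex}) :
  0 <= lam <= 1 -> 0 < alpha -> 0 < b ->
  (forall n p, p \in B n -> hexagon lam (b * n%:R `^ alpha) p) ->
  forall e, 0 < e -> exists N, forall n, (N <= n)%N ->
    #|` B n|%:R <= ((4 - 2 * lam) * b ^+ 2 + e) * n%:R `^ (2 * alpha).
Proof.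
move=> lam01 a0 b0 hB e e0.
have [N1 H1] := power_ge ((6 * b + 1) / e) a0.
have [N2 H2] := power_ge 1 a0.
exists (maxn N1 N2) => n; rewrite geq_max => /andP[/H1 k1 /H2 k2].
set x := n%:R `^ alpha in k1 k2.
have xE : n%:R `^ (2 * alpha) = x ^+ 2.
  by rewrite -powR_mulrn ?powR_ge0// -powRrM; congr (_ `^ _); lra.
have M0 : 0 <= b * x by rewrite mulr_ge0//; lra.
apply: (@le_trans _ _ (size (hexagon_seq lam (b * x)))%:R).
  rewrite ler_nat; apply: uniq_leq_size; first exact: fset_uniq.
  by move=> p /hB; rewrite mem_hexagon_seq.
apply: le_trans (size_hexagon_seq lam01 M0) _.
rewrite xE [leRHS]mulrDl -addrA lerD//; first by rewrite exprMn mulrA.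
rewrite ler_pdivrMr// in k1; have : (6 * b + 1) * x <= x * e * x by rewrite ler_pM2r//; lra.
by nra.
Qed.

(** The turns are cut at eps n.  With y = n^(1/2) all the quantities are
    polynomials in y, the main terms have degree 6 and the errors degree at
    most 5. *)
Lemma card_le_critical (R : realType) (alpha b ep : R) (f : nat -> nat) v :
  alpha = 3 / 2 -> 0 <= b -> 0 <= ep <= 1 ->
  (forall i w, (0 < i)%N -> v i = Some w ->
     `|w.1|%N%:R <= b * i%:R `^ alpha + 1 /\ `|w.2|%N%:R <= b * i%:R `^ alpha + 1) ->
  forall e, 0 < e -> exists N, forall n, (N <= n)%N ->
    #|` burning f v n|%:R <=
      (4 * b ^+ 2 * ep ^+ 3 + 2 / 3 * (1 - ep) ^+ 3 + e) * n%:R `^ (2 * alpha).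
Proof.
move=> aE b0 /andP[ep0 ep1] hv e e0.
pose s := ep `^ alpha.
have s0 : 0 <= s by exact: powR_ge0.
have sE : s ^+ 2 = ep ^+ 3.
  by rewrite -[s ^+ 2]powR_mulrn// -powRrM -powR_mulrn//; congr (_ `^ _); lra.
pose A := 2 * b * s.
have A0 : 0 <= A by rewrite !mulr_ge0.
have [|N1 H1] := @power_ge _ (1 / 2) ((14 * A + 55) / e); first by lra.
exists (maxn 1 N1) => n; rewrite geq_max => /andP[n0 /H1].
set y := n%:R `^ (1 / 2) => k1.
have nR : 1 <= n%:R :> R by rewrite ler1n.
have nE : n%:R = y ^+ 2.
  by rewrite -powR_mulrn ?powR_ge0// -powRrM -[LHS]powRr1//; congr (_ `^ _); lra.
have y0 : 0 <= y by exact: powR_ge0.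
have y1 : 1 <= y.
  by rewrite nE in nR; nra.
have naE : n%:R `^ alpha = y ^+ 3.
  by rewrite -[y ^+ 3]powR_mulrn// -powRrM; congr (_ `^ _); lra.
have n2aE : n%:R `^ (2 * alpha) = y ^+ 6.
  by rewrite -[y ^+ 6]powR_mulrn// -powRrM; congr (_ `^ _); lra.
pose j := Num.truncn (ep * n%:R).
have x0 : 0 <= ep * n%:R by rewrite mulr_ge0.
have /andP[j1 j2] := truncn_itv x0; rewrite -/j -natr1 in j1 j2.
have jn : (j <= n)%N by rewrite -(ler_nat R); nra.
pose m := Num.truncn (b * s * y ^+ 3 + 1).
have m0 : 0 <= b * s * y ^+ 3 + 1 by rewrite addr_ge0 ?mulr_ge0 ?exprn_ge0.
have /andP[m1 _] := truncn_itv m0; rewrite -/m in m1.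
have hm i w : (0 < i <= j)%N -> v i = Some w ->
    (`|w.1| <= m)%N /\ (`|w.2| <= m)%N.
  move=> /andP[i0 ij] /(hv _ _ i0)[w1 w2].
  have ib : b * i%:R `^ alpha + 1 <= b * s * y ^+ 3 + 1.
    rewrite lerD2r -mulrA ler_wpM2l// -naE -powRM//.
    rewrite ge0_ler_powR ?nnegrE//; first by lra.
    by apply: le_trans j1; rewrite ler_nat.
  by rewrite /m !truncn_ge_nat//; split; [exact: le_trans w1 ib|exact: le_trans w2 ib].
have := @card_burning_le f v n j m hm; rewrite -(ler_nat R) => h.
apply: le_trans h _; rewrite natrD natrX natrD natrM natrD.
have := sum_l1ball_size (n - j); set S := (\sum_(l < _) _)%N => SE.
have {}SE : 3 * S%:R = 2 * (n%:R - j%:R) ^+ 3 + (n%:R - j%:R) :> R.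
  by rewrite -natrB// -natrX -!natrM -natrD SE.
have jP : 0 <= (n%:R - j%:R : R) by rewrite subr_ge0 ler_nat.
have j3 : n%:R - j%:R <= (1 - ep) * y ^+ 2 + 1 :> R by rewrite nE in j2 *; lra.
have S3 : (n%:R - j%:R) ^+ 3 <= ((1 - ep) * y ^+ 2 + 1) ^+ 3 :> R.
  by rewrite ler_pXn2r ?nnegrE//; lra.
have main : (2 * (m%:R + n%:R) + 1) ^+ 2 <= (A * y ^+ 3 + 7 * y ^+ 2) ^+ 2.
  have r0 : 0 <= A * y ^+ 3 + 7 * y ^+ 2.
    by rewrite addr_ge0// mulr_ge0// exprn_ge0.
  have l0 : 0 <= 2 * (m%:R + n%:R) + 1 :> R by rewrite addr_ge0// mulr_ge0// addr_ge0.
  rewrite ler_pXn2r ?nnegrE//.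
  have Y1 : 1 <= y ^+ 2 by rewrite expr_ge1.
  by rewrite nE /A; lra.
rewrite n2aE; rewrite nE in main *.
have y45 : y ^+ 4 <= y ^+ 5 by rewrite ler_weXn2l.
have Y1 : 1 <= y ^+ 2 by rewrite expr_ge1.
have y4E : y ^+ 4 = y ^+ 2 * y ^+ 2 by ring.
have S4 : S%:R <= 2 / 3 * (1 - ep) ^+ 3 * y ^+ 6 + 6 * y ^+ 4.
  have q0 : 0 <= 1 - ep by lra.
  have q1 : 1 - ep <= 1 by lra.
  have e6 : y ^+ 6 = (y ^+ 2) ^+ 3 by ring.
  have : ((1 - ep) * y ^+ 2 + 1) ^+ 3 <= (1 - ep) ^+ 3 * y ^+ 6 + 7 * y ^+ 4.
    rewrite e6 y4E; move: (y ^+ 2) Y1 => Y Y1.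
    have qY : (1 - ep) * Y <= Y by nra.
    have qY0 : 0 <= (1 - ep) * Y by nra.
    have -> : ((1 - ep) * Y + 1) ^+ 3 = (1 - ep) ^+ 3 * Y ^+ 3 +
      (3 * (((1 - ep) * Y) * ((1 - ep) * Y)) + 3 * ((1 - ep) * Y) + 1) by ring.
    by rewrite lerD2l; nra.
  have : (1 - ep) * y ^+ 2 + 1 <= 2 * y ^+ 4 by rewrite y4E; nra.
  by move: j3 S3 SE; rewrite nE; lra.
have k2 : (14 * A + 55) * y ^+ 5 <= e * y ^+ 6.
  rewrite ler_pdivrMr// in k1.
  have -> : e * y ^+ 6 = y * e * y ^+ 5 by ring.
  by rewrite ler_wpM2r// exprn_ge0.
have AE : (A * y ^+ 3 + 7 * y ^+ 2) ^+ 2 =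
  4 * b ^+ 2 * ep ^+ 3 * y ^+ 6 + 14 * A * y ^+ 5 + 49 * y ^+ 4.
  by rewrite -sE /A; ring.
by lra.
Qed.

(** At this eps one has 1 - eps = sqrt 6 b eps, which minimizes the left-hand
    side and turns its second term into 4 b^2 eps^2 (1 - eps). *)
Lemma critical_value (R : realType) (b : R) : 0 < b ->
  let ep := (1 + Num.sqrt 6 * b)^-1 in
  4 * b ^+ 2 * ep ^+ 3 + 2 / 3 * (1 - ep) ^+ 3 = 4 * b ^+ 2 * ep ^+ 2.
Proof.
move=> b0 ep; set s := Num.sqrt 6 in ep *.
have s0 : 0 <= s by exact: sqrtr_ge0.
have sb : 0 <= s * b by rewrite mulr_ge0// ltW.
have s2 : s ^+ 2 = 6 by rewrite sqr_sqrtr.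
have -> : 1 - ep = s * b * ep by rewrite /ep; field; rewrite gt_eqF//; lra.
have -> : 4 * b ^+ 2 * ep ^+ 3 + 2 / 3 * (s * b * ep) ^+ 3 =
  b ^+ 2 * ep ^+ 3 * (4 + 2 / 3 * s ^+ 2 * (s * b)) by field.
rewrite s2 /ep; field; rewrite gt_eqF//; lra.
Qed.

(** * Densities that are attained *)

(** The sequence of [packing], started late enough for the grid to outrun the
    fire. *)
Lemma ignition (R : realType) (lam alpha b c : R) (k : nat) :
  0 <= lam <= 1 -> 1 <= alpha -> 0 < b <= c -> (alpha = 1 -> 1 <= c) ->
  let f := power_growth c alpha in
  exists v (r : nat -> nat) i0,
  [/\ (k <= i0)%N /\ activator_sequence f v,
      forall i w, v i = Some w -> (i0 <= i)%N /\ hexagon lam (b * i%:R `^ alpha) w,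
      forall gamma, 0 < gamma -> gamma ^+ 2 < alpha * ((4 - 2 * lam) * b ^+ 2) ->
        exists N, forall i, (N <= i)%N ->
          gamma * i%:R `^ (alpha - 1 / 2) <= (r i)%:R
    & forall n, \sum_(i0 <= i < n.+1) (2 * minn (n - i) (r i) ^ 2)%:R <=
        #|` burning f v n|%:R :> R].
Proof.
move=> lam01 a1 /andP[b0 bc] ac f.
have c0 : 0 < c by exact: lt_le_trans bc.
have [u [r [i1 [uh ud ur]]]] := packing lam01 a1 b0.
have [N HN] := power_growth_lt c0 a1 ac.
pose i0 := maxn (maxn 1 k) (maxn i1 N).
have [i01 i0k i0i i0N] : [/\ (1 <= i0)%N, (k <= i0)%N, (i1 <= i0)%N & (N <= i0)%N].
  by rewrite /i0; split; rewrite !leq_max leqnn ?orbT.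
pose v i := if (i0 <= i)%N then Some (u i) else None.
have ug i : (i0 <= i)%N -> u i \in grid (f i).
  move=> ii; have /andP[h1 h2] := uh i (leq_trans i0i ii).
  have /andP[h3 _] := power_growth_itv alpha c0 i; rewrite -/f in h3.
  have bx : b * i%:R `^ alpha <= c * i%:R `^ alpha by rewrite ler_wpM2r// powR_ge0.
  have l0 : 0 <= lam * `|(u i).1|%N%:R by rewrite mulr_ge0//; case/andP: lam01.
  have w1 : (`|(u i).1| <= f i)%N by rewrite -(ler_nat R); lra.
  have w2 : (`|(u i).2| <= f i)%N by rewrite -(ler_nat R); lra.
  by rewrite mem_grid -!abszE !lez_nat w1 w2.
exists v, r, i0; split.
- split=> //; split; last by exists i0; rewrite // /v leqnn.
  by move=> n w _; rewrite /v; case: ifP => // ii [<-]; exact: ug.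
- move=> i w; rewrite /v; case: ifP => // ii [<-]; split => //.
  exact: uh (leq_trans i0i ii).
- move=> gamma g0 gP; apply: ur => //; move: gP.
  by congr (_ < _); ring.
move=> n; rewrite -natr_sum ler_nat; apply: card_burning_ge => //.
- by move=> m im; apply: HN; exact: leq_trans im.
- by move=> i ii; rewrite /v ii; split => //; exact: ug.
- by move=> i j ii; apply: ud; exact: leq_trans ii.
Qed.

(** The hypothesis on b when alpha = 1 makes the hexagon grow by one unit per
    turn, so that the fire stays inside. *)
Lemma fill_subcritical (R : realType) (lam alpha b c : R) :
  0 <= lam <= 1 -> 1 <= alpha -> alpha < 3 / 2 -> 0 < b <= c ->
  (alpha = 1 -> 1 <= b) ->
  exists v, activator_sequence (power_growth c alpha) v /\
    has_burning_density (power_growth c alpha) v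
      ((4 - 2 * lam) * b ^+ 2 / (4 * c ^+ 2)).
Proof.
move=> lam01 a1 a2 bc ab; have /andP[b0 bc'] := bc; have /andP[l0 l1'] := lam01.
have ac : alpha = 1 -> 1 <= c by move=> /ab h; exact: le_trans bc'.
have [k Hk] := power_step b0 a1 ab.
have [v [r [i0 [[ki0 va] vh vr vs]]]] := ignition k lam01 a1 bc ac.
exists v; split => //; apply/has_burning_densityP.
apply: burned_fraction_cvg => //; first exact: lt_le_trans bc'.
have P0 : 0 < (4 - 2 * lam) * b ^+ 2 by rewrite mulr_gt0 ?exprn_gt0//; lra.
have w0 : exists N, forall n, (N <= n)%N -> 0 < n%:R `^ (2 * alpha) :> R.
  by exists 1%N => n n0; rewrite powR_gt0// ltr0n.
have [N0 HN0] := w0.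
apply: cvg_of_bounds => e e0.
  have [||N HN] := @card_le_hexagon R lam alpha b
    (burning (power_growth c alpha) v) lam01 _ b0 _ e e0.
  - by lra.
  - move=> n p; apply: burning_sub_hexagon vh => // m im; apply: Hk.
    exact: leq_trans im.
  exists (maxn N0 N) => n; rewrite geq_max => /andP[/HN0 n0 /HN h].
  by rewrite ler_pdivrMr.
have [N HN] := packing_sum_subcritical i0 a1 a2 P0 vr e0.
exists (maxn N0 N) => n; rewrite geq_max => /andP[/HN0 n0 /HN h].
by rewrite ler_pdivlMr//; exact: le_trans h (vs n).
Qed.

Lemma fill_critical (R : realType) (b c : R) : 0 < b <= c ->
  exists v, activator_sequence (power_growth c (3 / 2)) v /\
    has_burning_density (power_growth c (3 / 2)) v
      ((b / (c * (1 + Num.sqrt 6 * b))) ^+ 2).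
Proof.
move=> bc; have /andP[b0 bc'] := bc.
have c0 : 0 < c by exact: lt_le_trans bc'.
pose alpha : R := 3 / 2; rewrite -/alpha.
have lam01 : 0 <= (0 : R) <= 1 by apply/andP; split; lra.
have a1 : 1 <= alpha by rewrite /alpha; lra.
have ac : alpha = 1 -> 1 <= c by rewrite /alpha; lra.
have [v [r [i0 [[_ va] vh vr vs]]]] := ignition 0 lam01 a1 bc ac.
exists v; split => //; apply/has_burning_densityP.
have sb : 0 <= Num.sqrt 6 * b by rewrite mulr_ge0 ?sqrtr_ge0// ltW.
pose ep := (1 + Num.sqrt 6 * b)^-1.
have -> : (b / (c * (1 + Num.sqrt 6 * b))) ^+ 2 = (4 * b ^+ 2 * ep ^+ 2) / (4 * c ^+ 2).
  by rewrite /ep; field; rewrite !gt_eqF//; lra.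
apply: burned_fraction_cvg => //.
apply: cvg_of_bounds => e e0.
  have ep01 : 0 <= ep <= 1.
    by rewrite invr_ge0 addr_ge0//= invf_le1; lra.
  have [|N HN] := @card_le_critical R alpha b ep (power_growth c alpha) v
    erefl (ltW b0) ep01 _ e e0.
    move=> i w i_gt0 /vh[_ /andP[h1 h2]]; move: h2; rewrite mul0r addr0.
    by split; lra.
  exists (maxn 1 N) => n; rewrite geq_max => /andP[n0 /HN].
  by rewrite critical_value// ler_pdivrMr// powR_gt0// ltr0n.
have P0 : 0 < (4 - 2 * 0) * b ^+ 2 by rewrite mulr_gt0 ?exprn_gt0//; lra.
have [N HN] := packing_sum_critical i0 a1 erefl P0 vr e0.
exists (maxn 1 N) => n; rewrite geq_max => /andP[n0 /HN h].
rewrite ler_pdivlMr ?powR_gt0 ?ltr0n//; apply: le_trans (vs n); apply: le_trans h.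
rewrite ler_pM2r ?powR_gt0 ?ltr0n// lerD2r.
have -> : Num.sqrt (alpha * ((4 - 2 * 0) * b ^+ 2)) = Num.sqrt 6 * b.
  rewrite -[in RHS](ger0_norm (ltW b0)) -sqrtr_sqr -sqrtrM//.
  by congr Num.sqrt; rewrite /alpha; field.
have -> : 2 / 3 * (Num.sqrt 6 * b / (1 + Num.sqrt 6 * b)) ^+ 2 =
  2 / 3 * (Num.sqrt 6 ^+ 2) * b ^+ 2 * ep ^+ 2.
  by rewrite /ep; field; rewrite gt_eqF//; lra.
by rewrite sqr_sqrtr//; lra.
Qed.

Lemma density0 (R : realType) (alpha c : R) : 0 < c -> 1 < alpha ->
  burning_densities R (power_growth c alpha) 0.
Proof.
move=> c0 a1; split; first by rewrite lexx ler01.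
exists spark; split; first exact: spark_activator.
apply/has_burning_densityP; rewrite -(mul0r (4 * c ^+ 2)^-1).
apply: burned_fraction_cvg => //; first exact: ltW.
apply: (@ratio_cvg0 _ _ 9 2); [by []|lra|] => n n0; rewrite ler0n /=.
by rewrite (powR_mulrn 2)// -natrX -natrM ler_nat card_spark.
Qed.

(** * Constraints on densities *)

(** The ball of a single activated vertex already has this density. *)
Lemma density_linear_ge (R : realType) (c rho : R) : 1 <= c ->
  burning_densities R (power_growth c 1) rho -> 1 / (2 * c ^+ 2) <= rho.
Proof.
move=> c1 [_ [v [[va [i i0 vi]] /has_burning_densityP h]]].
have c0 : 0 < c by lra.
have {}h := card_ratio_cvg (lexx 1) c0 h.
case E : (v i) vi => [w|]// _.
have fS m : (power_growth c 1 m < power_growth c 1 m.+1)%N.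
  have /andP[_ h1] := power_growth_itv 1 c0 m.
  have /andP[h2 _] := power_growth_itv 1 c0 m.+1.
  by rewrite -(ltr_nat R); move: h1 h2; rewrite !powRr1// -natr1; lra.
have h2 : (1 - i%:R * n%:R^-1) * (1 - i%:R * n%:R^-1) * 2 @[n --> \oo] -->
    ((1 - i%:R * 0) * (1 - i%:R * 0) * 2 : R).
  have hi : 1 - i%:R * n%:R^-1 @[n --> \oo] --> (1 - i%:R * 0 : R).
    apply: cvgB; first exact: cvg_cst.
    apply: cvgM; first exact: cvg_cst.
    rewrite gtr0_cvgV0; first exact: cvgr_idn.
    by exists 1%N => // n /= n0; rewrite ltr0n.
  by apply: cvgM; [exact: cvgM|exact: cvg_cst].
rewrite mulr0 subr0 !mul1r in h2.
have : 2 <= rho * (4 * c ^+ 2).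
  apply: (ler_cvg_to h2 h); exists (maxn 1 i) => // n /=.
  rewrite geq_max => /andP[n0 iN].
  have nR : 0 < n%:R :> R by rewrite ltr0n.
  rewrite ler_pdivlMr ?powR_gt0// mulr1 (powR_mulrn 2)//.
  have -> : (1 - i%:R / n%:R) * (1 - i%:R / n%:R) * 2 * n%:R ^+ 2 = 2 * (n - i)%:R ^+ 2 :> R.
    by rewrite natrB//; field; rewrite gt_eqF.
  rewrite -natrX -natrM ler_nat.
  apply: (@leq_trans (size (l1ball w (n - i)))); first by rewrite size_l1ball; lia.
  apply: uniq_leq_size; first exact: l1ball_uniq.
  move=> u; rewrite mem_l1ball => d.
  apply: (balls_sub_burning _ _ E (va i w i0 E) d); first by rewrite i0.
  by [].
have c2 : 0 < 2 * c ^+ 2 by rewrite mulr_gt0// exprn_gt0.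
by rewrite ler_pdivrMr//; lra.
Qed.

Lemma density_critical_le (R : realType) (c rho : R) : 0 < c ->
  burning_densities R (power_growth c (3 / 2)) rho ->
  rho <= (1 + Num.sqrt 6 * c) ^- 2.
Proof.
move=> c0 [_ [v [[va _] /has_burning_densityP h]]].
pose alpha : R := 3 / 2; rewrite -/alpha in va h.
have a1 : 1 <= alpha by rewrite /alpha; lra.
have {}h := card_ratio_cvg a1 c0 h.
pose ep := (1 + Num.sqrt 6 * c)^-1.
have sc : 0 <= Num.sqrt 6 * c by rewrite mulr_ge0 ?sqrtr_ge0// ltW.
have ep01 : 0 <= ep <= 1 by rewrite invr_ge0 addr_ge0//= invf_le1; lra.
have -> : (1 + Num.sqrt 6 * c) ^- 2 = ep ^+ 2 by rewrite /ep exprVn.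
have c2 : 0 < 4 * c ^+ 2 by rewrite mulr_gt0// exprn_gt0.
rewrite -(ler_pM2r c2); apply/ler_addgt0Pr => e e0.
have [|N HN] := @card_le_critical R alpha c ep (power_growth c alpha) v
  erefl (ltW c0) ep01 _ e e0.
  move=> i w i0 vi; have := va i w i0 vi; rewrite mem_grid -!abszE !lez_nat.
  have /andP[_ h1] := power_growth_itv alpha c0 i.
  by rewrite -!(ler_nat R) => /andP[w1 w2]; split; lra.
apply: (ler_cvg_to h (cvg_cst (ep ^+ 2 * (4 * c ^+ 2) + e))).
exists (maxn 1 N) => // n /=; rewrite geq_max => /andP[n0 /HN].
rewrite critical_value// ler_pdivrMr ?powR_gt0 ?ltr0n//.
by rewrite (mulrC (ep ^+ 2)).
Qed.

Lemma density_supercritical (R : realType) (alpha c rho : R) : 0 < c -> 3 / 2 < alpha ->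
  burning_densities R (power_growth c alpha) rho -> rho = 0.
Proof.
move=> c0 a1 [_ [v [_ /has_burning_densityP h]]].
have h0 : burned_fraction R (power_growth c alpha) v n
    @[n --> \oo] --> (0 / (4 * c ^+ 2) : R).
  apply: burned_fraction_cvg => //; first by lra.
  apply: (@ratio_cvg0 _ _ 10 3); [by []|lra|] => n n0; rewrite ler0n /=.
  by rewrite (powR_mulrn 3)// -natrX -natrM ler_nat card_le_cubic.
by rewrite mul0r in h0; exact: (cvg_unique _ h h0).
Qed.

(** * The sets of densities *)

Theorem theorem1p1 (R : realType) (c alpha : R)
    (c_gt0 : 0 < c) (alpha_gt0 : 0 < alpha) :
  let P := burning_densities R (power_growth c alpha) in
  [/\ alpha = 1 -> 1 <= c -> P = `[1 / (2 * c ^+ 2), 1],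
      1 < alpha -> alpha < 3 / 2 -> P = `[0, 1],
      alpha = 3 / 2 -> P = `[0, (1 + Num.sqrt 6 * c) ^- 2]
    & 3 / 2 < alpha -> P = [set 0] ].
Proof.
move=> P; split.
- move=> aE c1; subst alpha; apply/seteqP; split=> rho.
    move=> Prho; rewrite /= in_itv /=; apply/andP; split.
      exact: density_linear_ge.
    by case: Prho => /andP[].
  rewrite /= in_itv /= => /andP[lo hi].
  have c2 : 0 < c ^+ 2 by rewrite exprn_gt0.
  have rc : 1 <= 2 * c ^+ 2 * rho.
    by move: lo; rewrite ler_pdivrMr ?mulr_gt0//; lra.
  have rho0 : 0 < rho by apply: lt_le_trans lo; rewrite divr_gt0// mulr_gt0.
  split; first by rewrite hi ltW.
  have [rho2|rho2] := leP rho (1 / 2).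
    (* L1 balls: lam = 1, and b >= 1 because rho >= 1 / (2 c^2). *)
    pose b := c * Num.sqrt (2 * rho).
    have r2 : 0 <= 2 * rho by lra.
    have bE : b ^+ 2 = c ^+ 2 * (2 * rho) by rewrite /b exprMn sqr_sqrtr.
    have b0 : 0 < b by rewrite mulr_gt0// sqrtr_gt0; lra.
    have b1 : 1 <= b.
      by rewrite -(@ler_pXn2r _ 2) ?nnegrE ?(ltW b0)// expr1n bE; lra.
    have bc : 0 < b <= c.
      by rewrite b0 ler_piMr ?(ltW c_gt0)// -[leRHS]sqrtr1 ler_wsqrtr//; lra.
    have [|||||v [va vd]] := @fill_subcritical R 1 1 b c => //; [|lra|].
      by rewrite ler01 lexx.
    exists v; split => //.
    suff <- : (4 - 2 * 1) * b ^+ 2 / (4 * c ^+ 2) = rho by [].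
    by rewrite bE; field; rewrite gt_eqF.
  (* Hexagons as wide as the grid: b = c, with lam adjusting the density. *)
  have bc : 0 < c <= c by rewrite c_gt0 lexx.
  have [|||||v [va vd]] := @fill_subcritical R (2 - 2 * rho) 1 c c => //; [|lra|].
    by apply/andP; split; lra.
  exists v; split => //.
  suff <- : (4 - 2 * (2 - 2 * rho)) * c ^+ 2 / (4 * c ^+ 2) = rho by [].
  by field; rewrite gt_eqF.
- move=> a1 a2; apply/seteqP; split=> rho; first by move=> [h _]; rewrite /= in_itv.
  rewrite /= in_itv /= => rho01; have /andP[rho0 rho1] := rho01.
  move: rho0; rewrite le_eqVlt => /predU1P[<-|rho0]; first exact: density0.
  split=> //; pose b := c * Num.sqrt rho.
  have bE : b ^+ 2 = c ^+ 2 * rho by rewrite /b exprMn sqr_sqrtr// ltW.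
  have bc : 0 < b <= c.
    rewrite mulr_gt0 ?sqrtr_gt0//= ler_piMr ?(ltW c_gt0)//.
    by rewrite -[leRHS]sqrtr1 ler_wsqrtr.
  have [|||||v [va vd]] := @fill_subcritical R 0 alpha b c => //.
  + by rewrite lexx ler01.
  + exact: ltW.
  + by move=> aE; move: a1; rewrite aE ltxx.
  exists v; split => //.
  suff <- : (4 - 2 * 0) * b ^+ 2 / (4 * c ^+ 2) = rho by [].
  by rewrite bE; field; rewrite gt_eqF.
- move=> aE; subst alpha; apply/seteqP; split=> rho.
    move=> Prho; rewrite /= in_itv /=; apply/andP; split; first by case: Prho => /andP[].
    exact: density_critical_le.
  rewrite /= in_itv /= => /andP[rho0 rho1].
  have s0 : 0 <= Num.sqrt 6 :> R by exact: sqrtr_ge0.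
  have sc : 0 <= Num.sqrt 6 * c by rewrite mulr_ge0// ltW.
  have u0 : 0 < 1 + Num.sqrt 6 * c by lra.
  move: rho0; rewrite le_eqVlt => /predU1P[<-|rho0].
    by apply: density0 => //; lra.
  have rho_le1 : rho <= 1.
    apply: le_trans rho1 _; rewrite invf_le1 ?exprn_gt0// expr_ge1//; lra.
  split; first by rewrite rho_le1 ltW.
  pose s := c * Num.sqrt rho.
  have q0 : 0 < Num.sqrt rho by rewrite sqrtr_gt0.
  have sp : 0 < s by rewrite mulr_gt0.
  have qu : Num.sqrt rho * (1 + Num.sqrt 6 * c) <= 1.
    rewrite -ler_pdivlMr// mul1r -(@ler_pXn2r _ 2) ?nnegrE ?invr_ge0 ?(ltW q0) ?(ltW u0)//.
    by rewrite sqr_sqrtr ?(ltW rho0)// exprVn.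
  have d0 : 0 < 1 - Num.sqrt 6 * s.
    by rewrite /s; move: qu; lra.
  (* The solution of b / (1 + sqrt 6 b) = s. *)
  pose b := s / (1 - Num.sqrt 6 * s).
  have bc : 0 < b <= c.
    rewrite divr_gt0//= ler_pdivrMr// /s.
    rewrite -(ler_pM2l c_gt0) in qu; lra.
  have [v [va vd]] := fill_critical bc.
  exists v; split => //.
  have bs : b / (c * (1 + Num.sqrt 6 * b)) = Num.sqrt rho.
    rewrite /b /s; field.
    by rewrite !gt_eqF//=; lra.
  by rewrite bs sqr_sqrtr ?(ltW rho0) in vd.
- move=> a2; apply/seteqP; split=> rho; first exact: density_supercritical.
  by move=> ->; apply: density0 => //; lra.
Qed.
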